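(* Let $F$ be a divisible $\nu$-archimedean $\nu$-semifield$^\dagger$ and $F(\Lambda)=F(\lambda_1,\dots,\lambda_n)$. Then $\mathrm{Hdim}(F(\Lambda))=d_{\mathrm{conv}}(F(\Lambda))=n$.
   Context: **Setting.** A semiring$^\dagger$ $(R,+,\cdot,1)$ is a semiring without zero: $(R,+)$ is an abelian semigroup, $(R,\cdot,1)$ a monoid, multiplication distributes over addition, and some $r_0,r_1\in R$ satisfy $r_0+r_1=1$. A $\nu$-domain$^\dagger$ is a quadruple $(R,\mathcal T,\nu,\mathcal G)$ with $R$ a semiring$^\dagger$, $\mathcal T\subset R$ a cancellative multiplicative submonoid (tangible elements), $\mathcal G$ an ideal of $R$ (ghosts) with a partial order, and $\nu:R\to\mathcal G$ an idempotent homomorphism with $\nu|_{\mathcal T}$ onto, such that $a+b=a$ if $\nu(a)>\nu(b)$ and $a+b=\nu(a)$ if $\nu(a)=\nu(b)$. It is a $\nu$-semifield$^\dagger$ if $\mathcal T$ is an abelian group. Write $a\cong_\nu b$ if $\nu(a)=\nu(b)$, and $a\ge_\nu b$ if $\nu(a)\ge\nu(b)$. $F$ is a $\nu$-archimedean (for $\alpha>_\nu1$ and any $\beta$, some $\alpha^k>_\nu\beta$), divisible $\nu$-semifield$^\dagger$. $F(\Lambda)$ is the $\nu$-semifield$^\dagger$ of fractions of the polynomial semiring$^\dagger$ $F[\Lambda]$, $\Lambda=\{\lambda_1,\dots,\lambda_n\}$; its elements are viewed as functions $F^{(n)}\to F$, and only those of the form $h/g$ with $h,g$ having tangible coefficients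 are used. Relations are understood up to $\cong_\nu$; $|f|=f+f^{-1}$. **Kernels.** A kernel of $F(\Lambda)$ is a multiplicative subgroup $K$ such that $a,b\in K$, $\alpha,\beta\in F(\Lambda)$, $\alpha+\beta\cong_\nu1$ imply $\alpha a+\beta b\in K$. $\langle S\rangle$ is the smallest kernel containing $S$; $K_1\cdot K_2=\{ab:a\in K_1,b\in K_2\}$ is a kernel. A principal kernel is one of the form $\langle f\rangle$. $\langle F\rangle$ is the kernel generated by any $\alpha\in F$ with $\alpha\not\cong_\nu1$. Write $f\sim_{\langle F\rangle}f'$ if $\langle f\rangle\cap\langle F\rangle=\langle f'\rangle\cap\langle F\rangle$. **Special kernels.** An $\mathscr L$-monomial is a non-constant Laurent monomial $f=h/g$, with $h,g\in F[\Lambda]$ non-proportional monomials. An HP-kernel is a principal kernel generated by an $\mathscr L$-monomial. An HS-fraction is $f\in F(\Lambda)$ with $f\sim_{\langle F\rangle}\sum_{i=1}^t|f_i|$ for non-proportional $\mathscr L$-monomials $f_i$; an HS-kernel is a principal kernel generated by an HS-fraction, the trivial kernel $\langle1\rangle$ being counted as an HS-kernel. $\Omega(F(\Lambda))$ is the lattice of kernels obtained from HP-kernels by finite intersections and products. $\langle f\rangle\in\Omega(F(\Lambda))$ is reducible if there are $\langle g\rangle,\langle h\rangle\in\Omega(F(\Lambda))$ with $\langle g\rangle,\langle h\rangle\not\subseteq\langle f\rangle$ but $\langle g\rangle\cap\langle h\rangle\subseteq\langle f\rangle$; otherwise irreducible. $\mathrm{HSpec}(F(\Lambda))$ is the family of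 irreducible kernels in $\Omega(F(\Lambda))$; it coincides with the family of HS-kernels. **Dimensions.** A chain $P_0\subset P_1\subset\dots\subset P_t$ (strict inclusions) in $\mathrm{HSpec}(F(\Lambda))$ has length $t$. An HS-kernel $P$ has height $t$ if there is a chain of length $t$ in $\mathrm{HSpec}(F(\Lambda))$ with largest member $P$ but none of length $t+1$. The hyperdimension $\mathrm{Hdim}(F(\Lambda))$ is the maximal height of the HS-kernels in $F(\Lambda)$. $\mathrm{HP}(F(\Lambda))$ is the set of $\mathscr L$-monomials. An element $f$ is $F$-convexly dependent on a set $A$ if $f\in\langle A\rangle\cdot\langle F\rangle$; a set $A$ is $F$-convexly independent if no $f\in A$ is $F$-convexly dependent on $A\setminus\{f\}$. $d_{\mathrm{conv}}(F(\Lambda))$ is the cardinality of a basis (a maximal $F$-convexly independent subset) of $\mathrm{HP}(F(\Lambda))$; all bases have the same cardinality.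
   Formalization: Members of HSpec are required to be proper kernels (otherwise F(Λ) itself is vacuously irreducible and gives chains of length n+1), and the partial order on ghosts is required to satisfy g ≤ g+h (otherwise the archimedean condition can be vacuous and ⟨F⟩ ill-defined). *)

(* Defs.v *)
From HB Require Import structures.
From mathcomp Require Import all_boot.
From mathcomp Require Import classical_sets functions cardinality.

Set Implicit Arguments.
Unset Strict Implicit.
Unset Printing Implicit Defensive.

Local Open Scope classical_set_scope.
Local Open Scope card_scope.
Local Open Scope ring_scope.
Local Open Scope group_scope.

(** * Semirings and nu-domains without zero (the dagger structures) *)

(* Addition lives in [ring_scope] (commutative, no neutral element);
   multiplication, 1 and powers live in [group_scope]. *)
HB.mixin Record isSemiringDagger R of Algebra.AddSemigroup R & Monoid R := {
  dagger_mulDl : forall a b c : R, (a + b) * c = a * c + b * c;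
  dagger_mulDr : forall a b c : R, a * (b + c) = a * b + a * c;
  dagger_one_split : exists r0 r1 : R, r0 + r1 = 1
}.

#[short(type="semiringDaggerType")]
HB.structure Definition SemiringDagger :=
  {R of Algebra.AddSemigroup R & Monoid R & isSemiringDagger R}.

(* [ghost_le_addr] is the compatibility between the partial order on the ghost
   ideal and its addition; with [ghost_addl] it says that the order is the
   natural one, g <= h iff g + h = h.  Without it the order could be, e.g.,
   equality, and nothing stated in terms of it would have any content. *)
HB.mixin Record isNuDomain R of SemiringDagger R := {
  tangible : set R;
  ghost : set R;
  nu : R -> R;
  ghost_le : R -> R -> Prop;
  tangible1 : tangible 1;
  tangibleM : forall a b : R, tangible a -> tangible b -> tangible (a * b);
  tangible_mulIl : forall a b c : R, tangible a -> tangible b -> tangible c ->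
    a * b = a * c -> b = c;
  tangible_mulIr : forall a b c : R, tangible a -> tangible b -> tangible c ->
    b * a = c * a -> b = c;
  ghostD : forall a b : R, ghost a -> ghost b -> ghost (a + b);
  ghostMl : forall r a : R, ghost a -> ghost (r * a);
  ghostMr : forall r a : R, ghost a -> ghost (a * r);
  ghost_le_refl : forall a : R, ghost a -> ghost_le a a;
  ghost_le_anti : forall a b : R, ghost a -> ghost b ->
    ghost_le a b -> ghost_le b a -> a = b;
  ghost_le_trans : forall a b c : R, ghost a -> ghost b -> ghost c ->
    ghost_le a b -> ghost_le b c -> ghost_le a c;
  ghost_le_addr : forall a b : R, ghost a -> ghost b -> ghost_le a (a + b);
  nu_ghost : forall a : R, ghost (nu a);
  nuD : forall a b : R, nu (a + b) = nu a + nu b;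
  nuM : forall a b : R, nu (a * b) = nu a * nu b;
  nu_idem : forall a : R, nu (nu a) = nu a;
  nu_tangible_onto : forall g : R, ghost g -> exists2 t : R, tangible t & nu t = g;
  ghost_addl : forall a b : R,
    ghost_le (nu b) (nu a) -> nu b <> nu a -> a + b = a;
  ghost_add_eq : forall a b : R, nu a = nu b -> a + b = nu a
}.

#[short(type="nuDomainType")]
HB.structure Definition NuDomain := {R of SemiringDagger R & isNuDomain R}.

HB.mixin Record isNuSemifield R of NuDomain R := {
  tangible_mulC : forall a b : R, tangible a -> tangible b -> a * b = b * a;
  tangible_inv : forall a : R, tangible a -> exists2 b : R, tangible b & a * b = 1
}.

#[short(type="nuSemifieldType")]
HB.structure Definition NuSemifield := {R of NuDomain R & isNuSemifield R}.

Definition nu_eq (R : nuDomainType) (a b : R) : Prop := nu a = nu b.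

Definition nu_lt (R : nuDomainType) (a b : R) : Prop :=
  ghost_le (nu a) (nu b) /\ nu a <> nu b.

Definition nu_archimedean (R : nuDomainType) : Prop :=
  forall a b : R, nu_lt 1 a -> exists k : nat, nu_lt b (a ^+ k).

Definition nu_divisible (R : nuDomainType) : Prop :=
  forall (a : R) (m : nat), (0 < m)%N -> exists b : R, nu_eq (b ^+ m) a.

Definition tangible_elt (R : nuDomainType) := {a : R | tangible a}.

Definition tmul (R : nuDomainType) (a b : tangible_elt R) : tangible_elt R :=
  exist _ (sval a * sval b) (tangibleM _ _ (svalP a) (svalP b)).

Definition tone (R : nuDomainType) : tangible_elt R := exist _ 1 tangible1.

(** * Polynomials with tangible coefficients and their fractions *)

Record monomial (F : nuSemifieldType) (n : nat) := Monomial {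
  mcoef : tangible_elt F;
  mexp : 'I_n -> nat
}.

Definition monomial_eval (F : nuSemifieldType) (n : nat)
    (m : monomial F n) (x : 'I_n -> F) : F :=
  sval (mcoef m) * \prod_(i < n) x i ^+ mexp m i.

Definition monomial_mul (F : nuSemifieldType) (n : nat) (m m' : monomial F n) :
    monomial F n :=
  Monomial (tmul (mcoef m) (mcoef m')) (fun i => mexp m i + mexp m' i)%N.

(* A polynomial is a nonempty formal sum of monomials: there is no zero
   polynomial.  Like terms are not collected; collecting a + a = nu a would
   leave the tangible coefficients, while up to nu the function defined by the
   sum is also given by tangible coefficients. *)
Record polynomial (F : nuSemifieldType) (n : nat) := Polynomial {
  phead : monomial F n;
  ptail : seq (monomial F n)
}.

Definition pterms (F : nuSemifieldType) (n : nat) (p : polynomial F n) :=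
  phead p :: ptail p.

Definition polynomial_eval (F : nuSemifieldType) (n : nat)
    (p : polynomial F n) (x : 'I_n -> F) : F :=
  foldl (fun s m => s + monomial_eval m x)
        (monomial_eval (phead p) x) (ptail p).

Definition polynomial_add (F : nuSemifieldType) (n : nat)
    (p q : polynomial F n) : polynomial F n :=
  Polynomial (phead p) (ptail p ++ pterms q).

Definition polynomial_mul (F : nuSemifieldType) (n : nat)
    (p q : polynomial F n) : polynomial F n :=
  Polynomial (monomial_mul (phead p) (phead q))
    (behead [seq monomial_mul a b | a <- pterms p, b <- pterms q]).

Definition poly_of_monomial (F : nuSemifieldType) (n : nat) (m : monomial F n) :
    polynomial F n := Polynomial m [::].

Definition poly_const (F : nuSemifieldType) (n : nat) (c : tangible_elt F) :
    polynomial F n := poly_of_monomial (Monomial c (fun=> 0%N)).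

(* The elements num / den of F(Lambda); they are compared by [fr_eq] below,
   never by Leibniz equality. *)
Record fraction (F : nuSemifieldType) (n : nat) := Fraction {
  num : polynomial F n;
  den : polynomial F n
}.

Definition fr_const (F : nuSemifieldType) (n : nat) (c : tangible_elt F) :
    fraction F n := Fraction (poly_const n c) (poly_const n (tone F)).

Definition fr_of_monomial (F : nuSemifieldType) (n : nat) (m : monomial F n) :
    fraction F n := Fraction (poly_of_monomial m) (poly_const n (tone F)).

Definition fr_add (F : nuSemifieldType) (n : nat) (f g : fraction F n) :
    fraction F n :=
  Fraction (polynomial_add (polynomial_mul (num f) (den g))
                           (polynomial_mul (num g) (den f)))
           (polynomial_mul (den f) (den g)).

Definition fr_mul (F : nuSemifieldType) (n : nat) (f g : fraction F n) :
    fraction F n :=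
  Fraction (polynomial_mul (num f) (num g)) (polynomial_mul (den f) (den g)).

Definition fr_inv (F : nuSemifieldType) (n : nat) (f : fraction F n) :
    fraction F n := Fraction (den f) (num f).

Definition fr_one (F : nuSemifieldType) (n : nat) : fraction F n :=
  fr_const n (tone F).

(* Equality up to nu of the functions F^(n) -> F defined by two fractions,
   with denominators cleared. *)
Definition fr_eq (F : nuSemifieldType) (n : nat) (f g : fraction F n) : Prop :=
  forall x : 'I_n -> F,
    nu_eq (polynomial_eval (num f) x * polynomial_eval (den g) x)
          (polynomial_eval (num g) x * polynomial_eval (den f) x).

Definition fr_abs (F : nuSemifieldType) (n : nat) (f : fraction F n) :
    fraction F n := fr_add f (fr_inv f).

(* f 0 + ... + f t, with t + 1 summands *)
Fixpoint fr_sum (F : nuSemifieldType) (n : nat) (f : nat -> fraction F n)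
    (t : nat) : fraction F n :=
  if t is t'.+1 then fr_add (fr_sum f t') (f t) else f 0%N.

(** * Kernels *)

(* As fractions are considered up to [fr_eq], a kernel is a saturated set. *)
Record is_kernel (F : nuSemifieldType) (n : nat) (K : set (fraction F n)) :
    Prop := IsKernel {
  kernel_fr_eq : forall f g, fr_eq f g -> K f -> K g;
  kernel_one : K (fr_one F n);
  kernel_mul : forall f g, K f -> K g -> K (fr_mul f g);
  kernel_inv : forall f, K f -> K (fr_inv f);
  kernel_convex : forall a b alpha beta, K a -> K b ->
    fr_eq (fr_add alpha beta) (fr_one F n) ->
    K (fr_add (fr_mul alpha a) (fr_mul beta b))
}.

Definition kernel_gen (F : nuSemifieldType) (n : nat) (S : set (fraction F n)) :
    set (fraction F n) :=
  \bigcap_(K in [set K | is_kernel K /\ S `<=` K]) K.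

Definition kernel_prod (F : nuSemifieldType) (n : nat)
    (K L : set (fraction F n)) : set (fraction F n) :=
  [set f | exists a b, [/\ K a, L b & fr_eq f (fr_mul a b)]].

(* <F>; [alpha] is any element of F that is not nu-equal to 1. *)
Definition kernel_F (F : nuSemifieldType) (n : nat) (alpha : tangible_elt F) :
    set (fraction F n) := kernel_gen [set fr_const n alpha].
Arguments kernel_F {F} n alpha.

Definition sim_F (F : nuSemifieldType) (n : nat) (alpha : tangible_elt F)
    (f g : fraction F n) : Prop :=
  kernel_gen [set f] `&` kernel_F n alpha =
  kernel_gen [set g] `&` kernel_F n alpha.

(** * Special kernels *)

Definition proportional (F : nuSemifieldType) (n : nat) (f g : fraction F n) :
    Prop := exists c : tangible_elt F, fr_eq f (fr_mul (fr_const n c) g).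

Definition Lmonomial (F : nuSemifieldType) (n : nat) (f : fraction F n) : Prop :=
  exists h g : monomial F n,
    ~ proportional (fr_of_monomial h) (fr_of_monomial g) /\
    fr_eq f (Fraction (poly_of_monomial h) (poly_of_monomial g)).

Definition HP_kernel (F : nuSemifieldType) (n : nat) (K : set (fraction F n)) :
    Prop := exists2 f, Lmonomial f & K = kernel_gen [set f].

Definition HS_fraction (F : nuSemifieldType) (n : nat) (alpha : tangible_elt F)
    (f : fraction F n) : Prop :=
  exists (t : nat) (g : nat -> fraction F n),
    [/\ forall i, (i <= t)%N -> Lmonomial (g i),
        forall i j, (i <= t)%N -> (j <= t)%N -> i <> j ->
          ~ proportional (g i) (g j)
      & sim_F alpha f (fr_sum (fun i => fr_abs (g i)) t)].

Definition trivial_kernel (F : nuSemifieldType) (n : nat) :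
    set (fraction F n) := kernel_gen [set fr_one F n].
Arguments trivial_kernel : clear implicits.

Definition HS_kernel (F : nuSemifieldType) (n : nat) (alpha : tangible_elt F)
    (K : set (fraction F n)) : Prop :=
  K = trivial_kernel F n \/
  exists2 f, HS_fraction alpha f & K = kernel_gen [set f].

(* The trivial kernel is the empty product of HP-kernels. *)
Inductive Omega (F : nuSemifieldType) (n : nat) : set (fraction F n) -> Prop :=
| Omega_trivial : Omega (trivial_kernel F n)
| Omega_HP K : HP_kernel K -> Omega K
| Omega_cap K L : Omega K -> Omega L -> Omega (K `&` L)
| Omega_prod K L : Omega K -> Omega L -> Omega (kernel_prod K L).

Definition reducible (F : nuSemifieldType) (n : nat) (K : set (fraction F n)) :
    Prop :=
  exists L M : set (fraction F n),
    [/\ Omega L, Omega M, ~ L `<=` K, ~ M `<=` K & L `&` M `<=` K].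

(* The irreducible kernels are proper, as points of a spectrum.  For n > 0 the
   whole of F(Lambda) = <lambda_1> . <a lambda_1> (a a constant, not nu-equal
   to 1) belongs to Omega and is vacuously not reducible; admitting it would
   make every hyperdimension with n > 0 larger by one. *)
Definition HSpec (F : nuSemifieldType) (n : nat) (K : set (fraction F n)) :
    Prop := [/\ Omega K, K <> setT & ~ reducible K].

(** * Hyperdimension and convex dimension *)

Definition HSpec_chain (F : nuSemifieldType) (n t : nat)
    (K : set (fraction F n)) : Prop :=
  exists P : nat -> set (fraction F n),
    [/\ forall i, (i <= t)%N -> HSpec (P i),
        forall i, (i < t)%N -> P i `<` P i.+1
      & P t = K].

Definition has_height (F : nuSemifieldType) (n : nat) (K : set (fraction F n))
    (t : nat) : Prop := HSpec_chain t K /\ ~ HSpec_chain t.+1 K.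

(* Hdim(F(Lambda)) = m: the maximum of the heights exists and equals m.  The
   last conjunct also says that every HS-kernel of the spectrum has a height,
   i.e. that the lengths of the chains below it are bounded. *)
Definition is_Hdim (F : nuSemifieldType) (n : nat) (alpha : tangible_elt F)
    (m : nat) : Prop :=
  (exists2 K : set (fraction F n), HS_kernel alpha K & has_height K m) /\
  (forall K : set (fraction F n), HS_kernel alpha K -> HSpec K ->
     exists2 t, (t <= m)%N & has_height K t).
Arguments is_Hdim {F} n alpha m.

Definition convexly_dependent (F : nuSemifieldType) (n : nat)
    (alpha : tangible_elt F) (f : fraction F n) (A : set (fraction F n)) : Prop :=
  kernel_prod (kernel_gen A) (kernel_F n alpha) f.

Definition convexly_independent (F : nuSemifieldType) (n : nat)
    (alpha : tangible_elt F) (A : set (fraction F n)) : Prop :=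
  forall f, A f -> ~ convexly_dependent alpha f (A `\ f).

Definition HP (F : nuSemifieldType) (n : nat) : set (fraction F n) :=
  [set f | Lmonomial f].
Arguments HP : clear implicits.

Definition is_basis (F : nuSemifieldType) (n : nat) (alpha : tangible_elt F)
    (B : set (fraction F n)) : Prop :=
  [/\ B `<=` HP F n, convexly_independent alpha B
    & forall C, C `<=` HP F n -> convexly_independent alpha C ->
        B `<=` C -> C = B].

(* d_conv(F(Lambda)) = m.  Distinct members of an independent set are never
   [fr_eq], so its cardinality does not depend on the choice of formal
   fractions for its elements. *)
Definition is_dconv (F : nuSemifieldType) (n : nat) (alpha : tangible_elt F)
    (m : nat) : Prop :=
  (exists B : set (fraction F n), is_basis alpha B) /\
  (forall B : set (fraction F n), is_basis alpha B -> B #= `I_m).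
Arguments is_dconv {F} n alpha m.

(* Main.v *)
(* Up to nu the elements of F(Lambda) are piecewise affine functions G^n -> G
   with integral slopes, where G is the group of nu-values; the archimedean
   hypothesis makes G totally ordered.  Kernels are convex subgroups closed
   under maxima, and irreducible members of Omega are generated by the
   L-monomials (non-constant affine functions) they contain.

   Hdim: along a chain in HSpec the rational span of the slopes of these
   L-monomials strictly grows, except that one step may adjoin the constants
   instead; a kernel with constants and all slopes is F(Lambda).  This bounds
   lengths by n.  The bound is attained by the kernels <lambda_1, ..., lambda_j>;
   for irreducibility, an L-monomial outside such a kernel has finitely many
   zeros on a suitable moment curve in the coordinate subspace.

   dconv: an L-monomial is F-convexly dependent on a set of L-monomials iff its
   slope lies in the rational span of their slopes. *)
From HB Require Import structures.
From mathcomp Require Import all_boot all_order all_algebra.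
From mathcomp Require Import boolp classical_sets functions cardinality.
Require Import Defs.

Set Implicit Arguments.
Unset Strict Implicit.
Unset Printing Implicit Defensive.

Import Order.TTheory GRing.Theory Num.Theory.
Local Open Scope classical_set_scope.
Local Open Scope ring_scope.

(** * The group of nu-values *)

(* The archimedean hypothesis is a parameter of the carrier because the order
   is total only under that hypothesis. *)
Definition value (F : nuSemifieldType) of nu_archimedean F :=
  {a : F | nu a == a}.

Section ValueGroup.
Variables (F : nuSemifieldType) (arch : nu_archimedean F).
Implicit Types (a b : F).
Local Notation G := (value arch).

HB.instance Definition _ := [isSub of G for @sval F _].
HB.instance Definition _ := [Choice of G by <:].

Definition to_value a : G := exist _ (nu a) (introT eqP (nu_idem a)).

Lemma nu_valK (x : G) : nu (val x) = val x.
Proof. exact/eqP/(valP x). Qed.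

Lemma to_valueK (x : G) : to_value (val x) = x.
Proof. by apply: val_inj; rewrite /= nu_valK. Qed.

Lemma to_value_eq a b : to_value a = to_value b <-> nu_eq a b.
Proof. by split=> [/(congr1 val)//|e]; apply: val_inj. Qed.

Lemma tangible_value (x : G) : exists2 t : F, tangible t & to_value t = x.
Proof.
have : ghost (val x) by rewrite -nu_valK; apply: nu_ghost.
by case/nu_tangible_onto => t tt e; exists t => //; apply: val_inj; rewrite /= e.
Qed.

(** The tropical reading of [F]: multiplication becomes the group law and addition becomes the
    join. *)
Definition vadd (x y : G) : G := to_value (val x * val y)%g.
Definition vmax (x y : G) : G := to_value (val x + val y).
Definition vzero : G := to_value 1%g.

Lemma to_valueM a b : to_value (a * b)%g = vadd (to_value a) (to_value b).
Proof. by apply: val_inj; rewrite /= !nuM !nu_idem. Qed.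

Lemma to_valueD a b : to_value (a + b) = vmax (to_value a) (to_value b).
Proof. by apply: val_inj; rewrite /= !nuD !nu_idem. Qed.

Lemma vaddA : associative vadd.
Proof.
move=> x y z; rewrite -(to_valueK x) -(to_valueK y) -(to_valueK z).
by rewrite -!to_valueM mulgA.
Qed.

(** Only tangible elements are assumed to commute, but every value has a tangible representative. *)
Lemma vaddC : commutative vadd.
Proof.
move=> x y; have [s ts <-] := tangible_value x; have [t tt <-] := tangible_value y.
by rewrite -!to_valueM tangible_mulC.
Qed.

Lemma vadd0 : left_id vzero vadd.
Proof. by move=> x; rewrite -(to_valueK x) -to_valueM mul1g. Qed.

Lemma vopp_subproof (x : G) : exists y : G, vadd y x == vzero.
Proof.
have [s ts <-] := tangible_value x; have [t _ e] := tangible_inv s ts.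
by exists (to_value t); rewrite vaddC -to_valueM e.
Qed.

Definition vopp (x : G) : G := xchoose (vopp_subproof x).

Lemma vaddN : left_inverse vzero vopp vadd.
Proof. by move=> x; apply/eqP; exact: (xchooseP (vopp_subproof x)). Qed.

HB.instance Definition _ := GRing.isZmodule.Build G vaddA vaddC vadd0 vaddN.

Lemma vmaxC : commutative vmax.
Proof. by move=> x y; rewrite /vmax Algebra.addrC. Qed.

Lemma vmaxA : associative vmax.
Proof.
move=> x y z; rewrite -(to_valueK x) -(to_valueK y) -(to_valueK z).
by rewrite -!to_valueD Algebra.addrA.
Qed.

Lemma vmaxx : idempotent_op vmax.
Proof.
by move=> x; apply: val_inj; rewrite /= nuD !nu_valK (ghost_add_eq _ _ erefl) nu_valK.
Qed.

Lemma vmaxDr (x y z : G) : x + vmax y z = vmax (x + y) (x + z).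
Proof.
rewrite -(to_valueK x) -(to_valueK y) -(to_valueK z) -to_valueD.
by rewrite -[_ + _]to_valueM dagger_mulDr to_valueD !to_valueM.
Qed.

(** The natural order of the join-semilattice; [nu_lt_value] identifies its strict part with
    [nu_lt]. *)
Definition vle (x y : G) := vmax x y == y.

Lemma vle_refl : reflexive vle.
Proof. by move=> x; rewrite /vle vmaxx. Qed.

Lemma vle_anti : antisymmetric vle.
Proof. by move=> x y /andP[/eqP xy /eqP yx]; rewrite -[RHS]xy vmaxC yx. Qed.

Lemma vle_trans : transitive vle.
Proof. by move=> y x z /eqP xy /eqP yz; rewrite /vle -yz vmaxA xy. Qed.

HB.instance Definition _ :=
  Order.Le_isPOrder.Build ring_display G vle_refl vle_anti vle_trans.

Lemma vleE (x y : G) : (x <= y) = (vmax x y == y).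
Proof. by []. Qed.

Lemma vmax_le (x y z : G) : (vmax x y <= z) = (x <= z) && (y <= z).
Proof.
apply/idP/andP => [/eqP e|[/eqP ex /eqP ey]]; last by rewrite vleE -vmaxA ey ex.
rewrite !vleE -e; split; first by rewrite !vmaxA vmaxx.
by rewrite (vmaxC x) !vmaxA vmaxx.
Qed.

Lemma vleD2l (z x y : G) : (z + x <= z + y) = (x <= y).
Proof. by rewrite !vleE -vmaxDr (inj_eq (addrI z)). Qed.

(** [ghost_addl] turns [ghost_le] into absorption under addition, and [ghost_le_addr] gives the
    converse. *)
Lemma nu_lt_value a b : nu_lt a b <-> to_value a < to_value b.
Proof.
have gle c d : ghost_le (nu c) (nu d) <-> to_value c <= to_value d.
  rewrite vleE -to_valueD; split=> [le|/eqP/to_value_eq e].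
    apply/eqP/to_value_eq; rewrite /nu_eq.
    have [e|/eqP ne] := eqVneq (nu c) (nu d).
      by rewrite nuD e (ghost_add_eq _ _ erefl) nu_idem.
    by rewrite Algebra.addrC nuD; apply: ghost_addl; rewrite !nu_idem.
  by rewrite -e nuD; apply: ghost_le_addr; apply: nu_ghost.
rewrite lt_neqAle /nu_lt; split=> [[/gle -> ne]|/andP[/eqP ne /gle le]].
  by rewrite andbT; apply/eqP => /to_value_eq.
by split=> // /to_value_eq.
Qed.

Lemma to_valueX a k : to_value (a ^+ k)%g = to_value a *+ k.
Proof. by elim: k => [|k IH]; rewrite ?expg0 // expgS mulrS to_valueM IH. Qed.

Lemma value_arch (x y : G) : 0 < x -> exists k, y < x *+ k.
Proof.
rewrite -(to_valueK x) -(to_valueK y) => x0.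
have /arch : nu_lt 1%g (val x) by apply/nu_lt_value.
by move=> /(_ (val y))[k /nu_lt_value]; rewrite to_valueX; exists k.
Qed.

Lemma vle_sub_add (x y z : G) : (x - y <= z) = (x <= y + z).
Proof. by rewrite -(vleD2l y (x - y)) addrC subrK. Qed.

(* The positive and negative parts [p] and [q] of [x] are disjoint, hence so are
   [p *+ k] and [q]; if both were nonzero some [p *+ k] would dominate [q]. *)
Lemma vle_total : total (<=%O : rel G).
Proof.
suff H (x : G) : (x <= 0) || (0 <= x).
  move=> x y; have := H (x - y).
  by rewrite vle_sub_add addr0 -[0 <= _](vleD2l y) addr0 [y + _]addrC subrK.
pose p := vmax x 0; pose q := vmax (- x) 0.
have p0 : 0 <= p by have := lexx p; rewrite vmax_le => /andP[].
have q0 : 0 <= q by have := lexx q; rewrite vmax_le => /andP[].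
have pq : p = x + q by rewrite vmaxDr subrr addr0 vmaxC.
have [e|pn] := eqVneq p 0; first by rewrite vleE; apply/orP; left; apply/eqP.
have pDq : p + q = vmax q p by rewrite {2}/q vmaxDr addr0 {1}pq addrAC subrr add0r.
(* Disjointness, min(p, q) <= 0, expressed through the opposites; it comes from p + q = max(q,
   p). *)
have pq1 : 0 <= vmax (- p) (- q).
  by rewrite -(vleD2l (p + q)) addr0 vmaxDr addrK (addrC p) addrK addrC pDq vmaxC.
have disj k : 0 <= vmax (- (p *+ k)) (- q).
  elim: k => [|k IH].
    by have := lexx (vmax (- (p *+ 0)) (- q)); rewrite {1}mulr0n oppr0 vmax_le => /andP[].
  apply: le_trans IH _; rewrite vmax_le; apply/andP; split; last first.
    by have := lexx (vmax (- (p *+ k.+1)) (- q)); rewrite vmax_le => /andP[].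
  rewrite -(vleD2l (- (p *+ k))) addr0 in pq1; apply: le_trans pq1 _.
  have := lexx (vmax (- (p *+ k.+1)) (- q)); rewrite vmax_le => /andP[a b].
  rewrite vmaxDr -opprD -mulrSr vmax_le a /=; apply: le_trans b.
  rewrite -(vleD2l q) subrr addrC subrK -(vleD2l (p *+ k)) subrr addr0.
  by elim: k {a} => // k IH; rewrite mulrS (le_trans p0) // -{1}[p]addr0 vleD2l.
have [|k /ltW lt] := value_arch (x := p) q; first by rewrite lt_neqAle eq_sym pn.
(* For this [k] both terms of the maximum in [disj k] are at most [- q]. *)
have q1 : 0 <= - q.
  apply: le_trans (disj k) _; rewrite vmax_le lexx andbT.
  by rewrite -(vleD2l (p *+ k)) subrr -(vleD2l q) addr0 addrC subrK.
suff e : q = 0 by have px : p = x; [rewrite pq e addr0|apply/orP; right; rewrite -px].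
by apply: le_anti; rewrite q0 andbT -(vleD2l (- q)) addrC subrr addr0.
Qed.

HB.instance Definition _ := Order.POrder_isTotal.Build ring_display G vle_total.

End ValueGroup.

(** * Arithmetic of the ordered value group and absolute values *)

Section OrderedValues.
Variables (F : nuSemifieldType) (arch : nu_archimedean F).
Local Notation G := (value arch).
Implicit Types x y z : G.

Lemma vmaxE x y : vmax x y = Num.max x y.
Proof.
apply: le_anti; rewrite vmax_le le_max lexx le_max lexx orbT /=.
by rewrite ge_max -vmax_le lexx.
Qed.

Lemma vmaxrD x y z : x + Num.max y z = Num.max (x + y) (x + z).
Proof. by rewrite -!vmaxE vmaxDr. Qed.

Lemma vleD2r z x y : (x + z <= y + z) = (x <= y).
Proof. by rewrite !(addrC _ z) vleD2l. Qed.

Lemma vleN2 x y : (- x <= - y) = (y <= x).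
Proof. by rewrite -(vleD2l (x + y) (- x)) addrK addrAC subrr add0r. Qed.

Lemma vleBl x y z : (x - y <= z) = (x <= z + y).
Proof. by rewrite -(vleD2r y (x - y)) subrK. Qed.

Lemma vsub_le0 x y : (x - y <= 0) = (x <= y).
Proof. by rewrite vleBl add0r. Qed.

Lemma voppr_le0 x : (- x <= 0) = (0 <= x).
Proof. by rewrite -{1}oppr0 vleN2. Qed.

Lemma voppr_ge0 x : (0 <= - x) = (x <= 0).
Proof. by rewrite -{1}oppr0 vleN2. Qed.

Lemma vleD x y z t : x <= y -> z <= t -> x + z <= y + t.
Proof. by move=> xy zt; apply: (@le_trans _ _ (y + z)); rewrite ?vleD2r ?vleD2l. Qed.

Lemma vmulrn_ge0 x k : 0 <= x -> 0 <= x *+ k.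
Proof. by move=> x0; elim: k => // k IH; rewrite mulrS -(addr0 0) vleD. Qed.

Lemma vmulrn_gt0 x k : 0 < x -> (0 < k)%N -> 0 < x *+ k.
Proof.
case: k => [|k] x0 // _; rewrite mulrS; apply: (lt_le_trans x0).
by rewrite -{1}[x]addr0 vleD2l vmulrn_ge0 // ltW.
Qed.

Lemma vmulrn_eq0 x k : (x *+ k == 0) = (x == 0) || (k == 0%N).
Proof.
case: k => [|k]; first by rewrite mulr0n !eqxx orbT.
rewrite orbF; case: (ltgtP x 0) => [x0|x0|->]; last by rewrite mul0rn eqxx.
  have : 0 < (- x) *+ k.+1.
    by rewrite vmulrn_gt0 // lt_neqAle voppr_ge0 ltW // eq_sym oppr_eq0 lt_eqF.
  by rewrite lt_neqAle mulNrn eq_sym oppr_eq0 => /andP[/negbTE].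
by have := vmulrn_gt0 x0 (ltn0Sn k); rewrite lt_neqAle eq_sym => /andP[/negbTE].
Qed.

Lemma vmulrz_eq0 x (k : int) : (x *~ k == 0) = (x == 0) || (k == 0).
Proof.
case: k => k; first exact: vmulrn_eq0.
by rewrite NegzE -[x *~ _]/(- (x *+ k.+1)) oppr_eq0 vmulrn_eq0 oppr_eq0.
Qed.

Definition vabs x := Num.max x (- x).

Lemma vabs_ge0 x : 0 <= vabs x.
Proof. by rewrite le_max voppr_ge0; case: (leP (0 : G) x) => // /ltW. Qed.

Lemma vabs_eq0 x : (vabs x == 0) = (x == 0).
Proof.
apply/eqP/eqP => [e|->]; last by rewrite /vabs oppr0 maxxx.
have: vabs x <= 0 by rewrite e.
by rewrite ge_max voppr_le0 => h; apply: le_anti.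
Qed.

Lemma vabs_le x y : (vabs x <= y) = (x <= y) && (- x <= y).
Proof. by rewrite ge_max. Qed.

Lemma vabs_muln x k : vabs (x *+ k) = vabs x *+ k.
Proof.
rewrite /vabs -mulNrn; case: (leP (0 : G) x) => [x0|/ltW x0].
  have nx : - x <= x by rewrite (@le_trans _ _ 0) ?voppr_le0.
  rewrite (max_l nx); apply: max_l.
  by rewrite (@le_trans _ _ 0) ?vmulrn_ge0 // mulNrn voppr_le0 vmulrn_ge0.
have nx : x <= - x by rewrite (@le_trans _ _ 0) ?voppr_ge0.
rewrite (max_r nx); apply: max_r.
rewrite (@le_trans _ _ 0) ?vmulrn_ge0 ?voppr_ge0 //.
by rewrite -voppr_ge0 -mulNrn vmulrn_ge0 ?voppr_ge0.
Qed.

Lemma value_arch_le x y : x != 0 -> exists k, vabs y <= vabs x *+ k.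
Proof.
move=> x0; have [|k /ltW] := @value_arch _ _ (vabs x) (vabs y); last by exists k.
by rewrite lt_neqAle eq_sym vabs_eq0 x0 vabs_ge0.
Qed.

End OrderedValues.

(** * Fractions as functions on the value group *)

Section Evaluation.
Variables (F : nuSemifieldType) (arch : nu_archimedean F) (n : nat).
Local Notation G := (value arch).
Implicit Types (y : 'I_n -> G) (p q : polynomial F n) (f g : fraction F n).

Definition mono_val (m : monomial F n) y : G :=
  to_value arch (sval (mcoef m)) + \sum_i y i *+ mexp m i.

Definition poly_val p y : G :=
  foldl (fun s m => Num.max s (mono_val m y)) (mono_val (phead p) y) (ptail p).

Definition fr_val f y : G := poly_val (num f) y - poly_val (den f) y.

Lemma to_value_mono (m : monomial F n) (x : 'I_n -> F) :
  to_value arch (monomial_eval m x) = mono_val m (fun i => to_value arch (x i)).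
Proof.
rewrite /monomial_eval to_valueM /mono_val; congr (_ + _).
rewrite (big_morph (to_value arch) (@to_valueM _ _) erefl).
by apply: eq_bigr => i _; rewrite to_valueX.
Qed.

Lemma to_value_poly p (x : 'I_n -> F) :
  to_value arch (polynomial_eval p x) = poly_val p (fun i => to_value arch (x i)).
Proof.
rewrite /polynomial_eval /poly_val -to_value_mono.
elim: (ptail p) (monomial_eval _ _) => //= m s IH a.
by rewrite IH to_valueD vmaxE to_value_mono.
Qed.

(** Every point of G^n comes from a point of F^n through [val], and the cleared denominators cancel
    in the group [G]. *)
Lemma fr_eqP f g : fr_eq f g <-> forall y, fr_val f y = fr_val g y.
Proof.
split=> H => [y|x].
  have {}H := H (fun i => val (y i)).
  have e : (fun i => to_value arch (val (y i))) = y.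
    by apply: funext => i; rewrite to_valueK.
  move/(to_value_eq arch): H; rewrite !to_valueM !to_value_poly e.
  move=> H; apply/eqP; rewrite subr_eq addrAC eq_sym subr_eq.
  by apply/eqP; exact: esym H.
apply/(to_value_eq arch); rewrite !to_valueM !to_value_poly.
move: (H (fun i => to_value arch (x i))) => /eqP.
by rewrite subr_eq addrAC eq_sym subr_eq eq_sym => /eqP.
Qed.

(** Maxima are handled through their upper bounds: with [le_eqP], identities for [poly_val] become
    statements about lists of terms. *)
Lemma poly_val_le p y (c : G) :
  (poly_val p y <= c) = all (fun m => mono_val m y <= c) (pterms p).
Proof.
rewrite /poly_val /=; elim: (ptail p) (mono_val _ _) => [|m s IH] a /=.
  by rewrite andbT.
by rewrite IH ge_max andbA.
Qed.

Lemma le_eqP (a b : G) : (forall c, (a <= c) = (b <= c)) -> a = b.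
Proof. by move=> H; apply: le_anti; rewrite H lexx -H lexx. Qed.

Lemma poly_val_add p q y :
  poly_val (polynomial_add p q) y = Num.max (poly_val p y) (poly_val q y).
Proof.
apply: le_eqP => c; rewrite ge_max !poly_val_le.
by rewrite -[pterms (polynomial_add p q)]/(pterms p ++ pterms q) all_cat.
Qed.

Lemma mono_val_mul (m m' : monomial F n) y :
  mono_val (monomial_mul m m') y = mono_val m y + mono_val m' y.
Proof.
rewrite /mono_val /= to_valueM addrACA -big_split /=; congr (_ + _).
by apply: eq_bigr => i _; rewrite mulrnDr.
Qed.

(** For a fixed term [a] of [p], the bounds over all terms of [q] combine into
    [poly_val q y <= c - mono_val a y]. *)
Lemma poly_val_mul p q y :
  poly_val (polynomial_mul p q) y = poly_val p y + poly_val q y.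
Proof.
apply: le_eqP => c; rewrite poly_val_le.
have -> : pterms (polynomial_mul p q) =
    [seq monomial_mul a b | a <- pterms p, b <- pterms q] by [].
rewrite -{1}[poly_val q y]opprK vleBl poly_val_le.
have := poly_val_le q y; move: (pterms q) => t qle.
elim: (pterms p) => //= a s IH; rewrite all_cat IH all_map; congr (_ && _).
rewrite -[RHS](vleD2r (poly_val q y)) subrK addrC -[mono_val a y]opprK vleBl qle.
by apply: eq_all => b; rewrite /= mono_val_mul -vleBl !opprK addrC.
Qed.

Lemma fr_val_add f g y :
  fr_val (fr_add f g) y = Num.max (fr_val f y) (fr_val g y).
Proof.
rewrite /fr_val /= poly_val_add !poly_val_mul addrC vmaxrD !opprD; congr Num.max.
  by rewrite -addrACA addNr addr0 addrC.
by rewrite [- _ - _]addrC addrACA addNr addr0 addrC.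
Qed.

Lemma fr_val_mul f g y : fr_val (fr_mul f g) y = fr_val f y + fr_val g y.
Proof. by rewrite /fr_val /= !poly_val_mul opprD addrACA. Qed.

Lemma fr_val_inv f y : fr_val (fr_inv f) y = - fr_val f y.
Proof. by rewrite /fr_val opprB. Qed.

Lemma fr_val_const c y : fr_val (fr_const n c) y = to_value arch (sval c).
Proof.
rewrite /fr_val /= /poly_val /= /mono_val /= big1 => [|i _]; last by rewrite mulr0n.
by rewrite -[to_value arch 1%g]/(0 : G) !addr0 subr0.
Qed.

Lemma fr_val_one y : fr_val (fr_one F n) y = 0.
Proof. exact: fr_val_const. Qed.

Lemma fr_val_abs f y : fr_val (fr_abs f) y = vabs (fr_val f y).
Proof. by rewrite fr_val_add fr_val_inv. Qed.

End Evaluation.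

(** * Kernels *)

Section Kernels.
Variables (F : nuSemifieldType) (arch : nu_archimedean F) (n : nat).
Local Notation G := (value arch).
Implicit Types (f g : fraction F n) (K L S : set (fraction F n)).
Implicit Types (y : 'I_n -> G).

Fixpoint fr_exp f k : fraction F n :=
  if k is k'.+1 then fr_mul f (fr_exp f k') else fr_one F n.

Lemma fr_val_exp f k y : fr_val (fr_exp f k) y = fr_val f y *+ k.
Proof.
by elim: k => [|k IH]; rewrite ?fr_val_one //= fr_val_mul IH mulrS.
Qed.

Definition fr_expz f (k : int) : fraction F n :=
  match k with Posz k => fr_exp f k | Negz k => fr_inv (fr_exp f k.+1) end.

Lemma fr_val_expz f k y : fr_val (fr_expz f k) y = fr_val f y *~ k.
Proof.
case: k => k; first exact: fr_val_exp.
by rewrite [fr_expz _ _]/(fr_inv (fr_exp f k.+1)) fr_val_inv fr_val_exp.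
Qed.

Definition fr_min f g := fr_inv (fr_add (fr_inv f) (fr_inv g)).

Lemma fr_val_min f g y : fr_val (fr_min f g) y = Num.min (fr_val f y) (fr_val g y).
Proof.
rewrite fr_val_inv fr_val_add !fr_val_inv.
case: (leP (fr_val f y) (fr_val g y)) => [le|/ltW le].
  by rewrite max_l ?opprK // vleN2.
by rewrite max_r ?opprK // vleN2.
Qed.

Lemma kernel_val K f g : is_kernel K ->
  (forall y, fr_val f y = fr_val g y) -> K f -> K g.
Proof. by move=> kK e; apply: (kernel_fr_eq kK); apply/fr_eqP. Qed.

Lemma kernel_exp K f k : is_kernel K -> K f -> K (fr_exp f k).
Proof.
move=> kK Kf; elim: k => [|k IH] /=; [exact: kernel_one|exact: kernel_mul].
Qed.

Lemma kernel_expz K f k : is_kernel K -> K f -> K (fr_expz f k).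
Proof.
by move=> kK Kf; case: k => k; [|apply: kernel_inv => //]; apply: kernel_exp.
Qed.

(** Convexity with both coefficients equal to 1, since max(0, 0) = 0. *)
Lemma kernel_add K f g : is_kernel K -> K f -> K g -> K (fr_add f g).
Proof.
move=> kK Kf Kg.
have /(kernel_convex kK Kf Kg) :
    fr_eq (fr_add (fr_one F n) (fr_one F n)) (fr_one F n).
  by apply/(fr_eqP arch) => y; rewrite fr_val_add fr_val_one maxxx.
by apply: kernel_val => // y; rewrite !fr_val_add !fr_val_mul !fr_val_one !add0r.
Qed.

Lemma kernel_abs K f : is_kernel K -> K f -> K (fr_abs f).
Proof. by move=> kK Kf; apply: kernel_add => //; apply: kernel_inv. Qed.

(** The positive part h of [f] is the convex combination 1 * 1 + (h / g) * g, because 0 <= h <= g in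
    values; the same holds for the negative part, and [f] is their quotient. *)
Lemma kernel_dominated K f g : is_kernel K -> K g ->
  (forall y, vabs (fr_val f y) <= fr_val g y) -> K f.
Proof.
move=> kK Kg fg.
have pos h : (forall y, fr_val h y <= fr_val g y) -> K (fr_add h (fr_one F n)).
  move=> hg; have p := kernel_convex kK (kernel_one kK) Kg.
  have /p : fr_eq (fr_add (fr_one F n)
     (fr_mul (fr_add h (fr_one F n)) (fr_inv g))) (fr_one F n).
    apply/(fr_eqP arch) => y; rewrite fr_val_add fr_val_mul fr_val_add.
    rewrite fr_val_inv fr_val_one max_l // vsub_le0 ge_max hg.
    by rewrite (le_trans _ (fg y)) // vabs_ge0.
  apply: kernel_val => // y.
  rewrite !(fr_val_add, fr_val_mul, fr_val_one, fr_val_inv) addr0 subrK.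
  by rewrite max_r // le_max lexx orbT.
have Kp : K (fr_add f (fr_one F n)).
  by apply: pos => y; have := fg y; rewrite vabs_le => /andP[].
have /(kernel_inv kK) Km : K (fr_add (fr_inv f) (fr_one F n)).
  by apply: pos => y; rewrite fr_val_inv; have := fg y; rewrite vabs_le => /andP[].
apply: kernel_val (kernel_mul kK Kp Km) => // y.
rewrite !(fr_val_add, fr_val_mul, fr_val_one, fr_val_inv).
case: (leP (0 : G) (fr_val f y)) => [f0|/ltW f0].
  by rewrite max_r ?voppr_le0 // subr0.
by rewrite max_l ?voppr_ge0 // opprK add0r.
Qed.

(** The absolute value of [f] is dominated by that of its k-th power. *)
Lemma kernel_root K f k : is_kernel K -> (0 < k)%N -> K (fr_exp f k) -> K f.
Proof.
move=> kK k0 /(kernel_abs kK) /kernel_dominated; apply=> // y.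
rewrite fr_val_abs fr_val_exp vabs_muln.
case: k k0 => // k _; rewrite mulrS -{1}[vabs _]addr0 vleD2l.
by rewrite vmulrn_ge0 ?vabs_ge0.
Qed.

(** By the archimedean property a power of one nonzero constant dominates any other constant. *)
Lemma kernel_const K f g (x z : G) : is_kernel K -> K f -> x != 0 ->
  (forall y, fr_val f y = x) -> (forall y, fr_val g y = z) -> K g.
Proof.
move=> kK Kf x0 fx gz; have [k le] := value_arch_le z x0.
apply: (kernel_dominated kK (kernel_exp k kK (kernel_abs kK Kf))) => y.
by rewrite gz fr_val_exp fr_val_abs fx.
Qed.

Lemma kernel_gen_is_kernel S : is_kernel (kernel_gen S).
Proof.
split.
- by move=> f g e H K [kK SK]; apply: kernel_fr_eq e (H K _).
- by move=> K [kK SK]; apply: kernel_one.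
- by move=> f g Hf Hg K KS; apply: (kernel_mul KS.1); [apply: Hf|apply: Hg].
- by move=> f Hf K KS; apply: (kernel_inv KS.1); apply: Hf.
- move=> a b al be Ha Hb e K KS.
  by apply: (kernel_convex KS.1) => //; [apply: Ha|apply: Hb].
Qed.

Lemma sub_kernel_gen S : S `<=` kernel_gen S.
Proof. by move=> f Sf K [_]; apply. Qed.

Lemma kernel_gen_min S K : is_kernel K -> S `<=` K -> kernel_gen S `<=` K.
Proof. by move=> kK SK f; apply. Qed.

Lemma kernel_gen_mono S L : S `<=` L -> kernel_gen S `<=` kernel_gen L.
Proof.
move=> SL; apply: kernel_gen_min (kernel_gen_is_kernel _) _.
exact: subset_trans SL (@sub_kernel_gen _).
Qed.

Lemma kernel_cap K L : is_kernel K -> is_kernel L -> is_kernel (K `&` L).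
Proof.
move=> kK kL; split.
- by move=> f g e [Kf Lf]; split; [apply: (kernel_fr_eq kK e)|apply: (kernel_fr_eq kL e)].
- by split; apply: kernel_one.
- by move=> f g [Kf Lf] [Kg Lg]; split; apply: kernel_mul.
- by move=> f [Kf Lf]; split; apply: kernel_inv.
- by move=> a b al be [Ka La] [Kb Lb] e; split; apply: kernel_convex.
Qed.

(* Convexity of a product: with [h = alpha a + beta a'], one has
   [alpha a b + beta a' b' = h (alpha' b + beta' b')] where [alpha' = alpha a / h]
   and [beta' = beta a' / h] again add up to 1. *)
Lemma kernel_prod_is_kernel K L :
  is_kernel K -> is_kernel L -> is_kernel (kernel_prod K L).
Proof.
move=> kK kL; split.
- move=> f g e [a [b [Ka Lb e']]]; exists a, b; split=> //.
  move/(fr_eqP arch): e => e; move/(fr_eqP arch): e' => e'.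
  by apply/(fr_eqP arch) => y; rewrite -e.
- exists (fr_one F n), (fr_one F n); split; [exact: kernel_one..|].
  by apply/(fr_eqP arch) => y; rewrite fr_val_mul fr_val_one addr0.
- move=> f g [a [b [Ka Lb /(fr_eqP arch) e]]] [a' [b' [Ka' Lb' /(fr_eqP arch) e']]].
  exists (fr_mul a a'), (fr_mul b b'); split; [exact: kernel_mul..|].
  by apply/(fr_eqP arch) => y; rewrite !fr_val_mul e e' !fr_val_mul addrACA.
- move=> f [a [b [Ka Lb /(fr_eqP arch) e]]].
  exists (fr_inv a), (fr_inv b); split; [exact: kernel_inv..|].
  by apply/(fr_eqP arch) => y; rewrite fr_val_mul !fr_val_inv e fr_val_mul opprD.
- move=> f g al be [a [b [Ka Lb /(fr_eqP arch) e]]].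
  move=> [a' [b' [Ka' Lb' /(fr_eqP arch) e']]] ab.
  pose h := fr_add (fr_mul al a) (fr_mul be a').
  pose al' := fr_mul (fr_mul al a) (fr_inv h).
  pose be' := fr_mul (fr_mul be a') (fr_inv h).
  exists h, (fr_add (fr_mul al' b) (fr_mul be' b')); split.
  + exact: kernel_convex.
  + apply: kernel_convex => //; apply/(fr_eqP arch) => y.
    rewrite !(fr_val_add, fr_val_mul, fr_val_one, fr_val_inv).
    by rewrite -!(addrC (- Num.max _ _)) -vmaxrD addNr.
  + apply/(fr_eqP arch) => y.
    rewrite /al' /be' !fr_val_mul !(fr_val_add, fr_val_mul, fr_val_inv) e e' !fr_val_mul.
    have E (u v w t : G) : w + (u + v - w + t) = u + (v + t).
      by rewrite addrA [w + _]addrC subrK addrA.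
    by rewrite vmaxrD !E.
Qed.

Lemma sub_kernel_prodl K L : is_kernel L -> K `<=` kernel_prod K L.
Proof.
move=> kL f Kf; exists f, (fr_one F n); split=> //; first exact: kernel_one.
by apply/(fr_eqP arch) => y; rewrite fr_val_mul fr_val_one addr0.
Qed.

Lemma sub_kernel_prodr K L : is_kernel K -> L `<=` kernel_prod K L.
Proof.
move=> kK f Lf; exists (fr_one F n), f; split=> //; first exact: kernel_one.
by apply/(fr_eqP arch) => y; rewrite fr_val_mul fr_val_one add0r.
Qed.

Lemma kernel_prod_min K L M : is_kernel M -> K `<=` M -> L `<=` M ->
  kernel_prod K L `<=` M.
Proof.
move=> kM KM LM f [a [b [/KM Ma /LM Mb /(fr_eqP arch) e]]].
exact: kernel_val (kernel_mul kM Ma Mb).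
Qed.

Lemma Omega_kernel K : Omega K -> is_kernel K.
Proof.
elim=> {K} [|K [f _ ->]|K L _ kK _ kL|K L _ kK _ kL].
- exact: kernel_gen_is_kernel.
- exact: kernel_gen_is_kernel.
- exact: kernel_cap.
- exact: kernel_prod_is_kernel.
Qed.

(* With [C] the condition [= 0] these are the functions vanishing on [Y]. *)
Lemma bounded_kernel (Y : set ('I_n -> G)) (C : set G) :
  C 0 -> (forall a b, C a -> C b -> C (a + b)) ->
  is_kernel [set f | exists2 c, C c & forall y, Y y -> vabs (fr_val f y) <= c].
Proof.
move=> C0 CD; split.
- move=> f g /(fr_eqP arch) e [c Cc fc]; exists c => // y Yy; rewrite -e; exact: fc.
- by exists 0 => // y _; rewrite fr_val_one /vabs oppr0 maxxx.
- move=> f g [c Cc fc] [d Cd gd]; exists (c + d); first exact: CD.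
  move=> y Yy; have := fc y Yy; have := gd y Yy; rewrite fr_val_mul !vabs_le.
  by move=> /andP[??] /andP[??]; rewrite opprD !vleD.
- move=> f [c Cc fc]; exists c => // y Yy; have := fc y Yy.
  by rewrite fr_val_inv !vabs_le opprK andbC.
- move=> a b al be [c Cc ac] [d Cd bd] /(fr_eqP arch) e.
  exists (c + d); first exact: CD.
  move=> y Yy; move: (e y) (ac y Yy) (bd y Yy).
  rewrite !(fr_val_add, fr_val_mul, fr_val_one) => m am bm.
  have c0 := le_trans (vabs_ge0 _) am; have d0 := le_trans (vabs_ge0 _) bm.
  move: am bm; rewrite !vabs_le => /andP[a1 a2] /andP[b1 b2].
  have : Num.max (fr_val al y) (fr_val be y) <= 0 by rewrite m.
  rewrite ge_max => /andP[al0 be0]; apply/andP; split.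
    have a3 : fr_val a y <= c + d by rewrite -[fr_val a y]addr0 vleD.
    have b3 : fr_val b y <= c + d by rewrite -[fr_val b y]add0r vleD.
    by rewrite ge_max -[c + d]add0r; apply/andP; split; apply: vleD.
  (* The lower bound uses that at each point one of the two coefficients attains the maximum 0. *)
  have [al1|be1] : fr_val al y = 0 \/ fr_val be y = 0.
      by move: m; case: (leP (fr_val al y) (fr_val be y)) => _; [right|left].
    rewrite al1 add0r -[_ <= _]vleN2 opprK le_max -(vleN2 (fr_val a y)) opprK.
    by rewrite -[X in X <= _]addr0 vleD.
  rewrite be1 add0r -[_ <= _]vleN2 opprK le_max -(vleN2 (fr_val b y)) opprK.
  by rewrite -[X in _ || (X <= _)]add0r vleD ?orbT.
Qed.

End Kernels.

(** * Slopes *)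

Section AffineFunctions.
Variables (F : nuSemifieldType) (arch : nu_archimedean F) (n : nat).
Local Notation G := (value arch).
Implicit Types (f g : fraction F n) (K L S : set (fraction F n)).
Implicit Types (y : 'I_n -> G) (m : 'I_n -> int) (c : G) (v : 'rV[rat]_n).

(** Kernels are saturated under [fr_eq], so membership depends only on the function; this spares
    writing a fraction for each affine expression. *)
Definition kmem K (phi : ('I_n -> G) -> G) := exists2 f, K f & fr_val f =1 phi.

Lemma kmem_val K f : is_kernel K -> kmem K (fr_val f) -> K f.
Proof. by move=> kK [g Kg e]; apply: kernel_val kK _ Kg. Qed.

Lemma kmem_ext K phi psi : phi =1 psi -> kmem K phi -> kmem K psi.
Proof. by move=> e [f Kf ef]; exists f => // y; rewrite ef e. Qed.

Lemma kmem0 K : is_kernel K -> kmem K (fun=> 0).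
Proof. by move=> kK; exists (fr_one F n); [exact: kernel_one|move=> y; exact: fr_val_one]. Qed.

Lemma kmemD K phi psi : is_kernel K ->
  kmem K phi -> kmem K psi -> kmem K (fun y => phi y + psi y).
Proof.
move=> kK [f Kf ef] [g Kg eg]; exists (fr_mul f g); first exact: kernel_mul.
by move=> y; rewrite fr_val_mul ef eg.
Qed.

Lemma kmemMz K phi (k : int) : is_kernel K -> kmem K phi -> kmem K (fun y => phi y *~ k).
Proof.
move=> kK [f Kf ef]; exists (fr_expz f k); first exact: kernel_expz.
by move=> y; rewrite fr_val_expz ef.
Qed.

Lemma kmem_sum K (I : Type) (r : seq I) (P : pred I) (phi : I -> ('I_n -> G) -> G) :
  is_kernel K -> (forall i, P i -> kmem K (phi i)) ->
  kmem K (fun y => \sum_(i <- r | P i) phi i y).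
Proof.
move=> kK H; elim: r => [|i r IH].
  by apply: kmem_ext (kmem0 kK) => y; rewrite big_nil.
case Pi: (P i); last by apply: kmem_ext IH => y; rewrite big_cons Pi.
by apply: kmem_ext (kmemD kK (H i Pi) IH) => y; rewrite big_cons Pi.
Qed.

Lemma kmem_root K phi (k : nat) f : is_kernel K -> (0 < k)%N ->
  kmem K phi -> (forall y, fr_val f y *+ k = phi y) -> K f.
Proof.
move=> kK k0 [g Kg eg] e; apply: (kernel_root arch kK k0).
by apply: kernel_val Kg => // y; rewrite fr_val_exp eg e.
Qed.

Definition affine c m y : G := c + \sum_i y i *~ m i.

Definition ratv m : 'rV[rat]_n := \row_i (m i)%:~R.

Definition has_const K := exists2 c : G, c != 0 & kmem K (fun=> c).

Lemma kmem_const K c : is_kernel K -> has_const K -> kmem K (fun=> c).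
Proof.
move=> kK [d d0 [f Kf ef]]; have [t tt e] := tangible_value c.
exists (fr_const n (exist _ t tt)); last by move=> y; rewrite fr_val_const.
by apply: (kernel_const kK Kf d0 ef) => y; rewrite fr_val_const.
Qed.

(** The denominator [N] and the free constant term make these vectors a rational vector space when
    [K] is a kernel. *)
Definition slope_of K v := exists N c m,
  [/\ (0 < N)%N, kmem K (affine c m) & N%:R *: v = ratv m].

Lemma slope_ofD K v w : is_kernel K ->
  slope_of K v -> slope_of K w -> slope_of K (v + w).
Proof.
move=> kK [N [c [m [N0 Kv ev]]]] [M [d [l [M0 Kw ew]]]].
exists (N * M)%N, (c *~ M + d *~ N), (fun i => m i * M + l i * N).
split; first by rewrite muln_gt0 N0.
  apply: kmem_ext (kmemD kK (kmemMz M kK Kv) (kmemMz N kK Kw)) => y.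
  rewrite /affine !mulrzDl_tmp addrACA; congr (_ + _).
  rewrite !mulrz_suml -big_split; apply: eq_bigr => i _ /=.
  by rewrite mulrzDr_tmp !mulrzA.
rewrite scalerDr natrM {1}mulrC -!scalerA ev ew.
by apply/rowP => i; rewrite !mxE rmorphD !rmorphM /= mulrC [_%:~R * N%:R]mulrC.
Qed.

Lemma slope_ofZ K a v : is_kernel K -> slope_of K v -> slope_of K (a *: v).
Proof.
move=> kK [N [c [m [N0 Kv ev]]]].
exists (N * `|denq a|)%N, (c *~ numq a), (fun i => m i * numq a); split.
- by rewrite muln_gt0 N0 absz_gt0 denq_eq0.
- apply: kmem_ext (kmemMz (numq a) kK Kv) => y.
  rewrite /affine mulrzDl_tmp mulrz_suml; congr (_ + _).
  by apply: eq_bigr => i _; rewrite mulrzA.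
- rewrite scalerA natrM (pmulrn 1 `|denq a|) absz_denq -mulrA [_ * a]mulrC -numqE.
  rewrite mulrC -scalerA ev.
  by apply/rowP => i; rewrite !mxE rmorphM mulrC.
Qed.

Lemma slope_of_span K (X : seq 'rV[rat]_n) w : is_kernel K ->
  (forall v, v \in X -> slope_of K v) -> w \in <<X>>%VS -> slope_of K w.
Proof.
move=> kK KX wX; rewrite (coord_span (X := in_tuple X) wX).
elim/big_rec: _ => [|i v _ Kv].
  exists 1%N, 0, (fun=> 0); split=> //; last first.
    by apply/rowP => i; rewrite !mxE mulr0.
  apply: kmem_ext (kmem0 kK) => y.
  by rewrite /affine add0r big1 // => i _; rewrite mulr0z.
apply: slope_ofD => //; apply: slope_ofZ => //; apply: KX.
exact: mem_nth.
Qed.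

Lemma slope_of_mono K L v : K `<=` L -> slope_of K v -> slope_of L v.
Proof.
move=> KL [N [c [m [N0 [f Kf ef] e]]]]; exists N, c, m; split=> //.
by exists f => //; apply: KL.
Qed.

Lemma slope_of_mem K f c m : K f -> fr_val f =1 affine c m -> slope_of K (ratv m).
Proof. by move=> Kf e; exists 1%N, c, m; split; [|exists f|rewrite scale1r]. Qed.

(* Some multiple of [f] differs from an element of [K] by a constant. *)
Lemma slope_of_cases K f c m : is_kernel K -> fr_val f =1 affine c m ->
  slope_of K (ratv m) ->
  K f \/ (~ has_const K /\ forall L, is_kernel L -> K `<=` L -> L f -> has_const L).
Proof.
move=> kK ef [N [d [l [N0 Kl e]]]].
have el i : l i = m i * N.
  move/rowP: e => /(_ i); rewrite !mxE => /eqP.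
  by rewrite (pmulrn 1 N) -intrM eqr_int mulrC eq_sym => /eqP ->.
have efN y : fr_val f y *+ N = affine d l y + (c *+ N - d).
  rewrite ef /affine mulrnDl [RHS]addrC addrA subrK; congr (_ + _).
  by rewrite pmulrn mulrz_suml; apply: eq_bigr => i _; rewrite el mulrzA.
have [cd|cd] := eqVneq (c *+ N - d) 0.
  by left; apply: (kmem_root kK N0 Kl) => y; rewrite efN cd addr0.
(* The nonzero difference is absorbed if [K] has constants; otherwise it lies in every larger kernel
   that contains [f]. *)
case: (pselect (has_const K)) => [hK|hK]; [left|right; split=> // L kL KL Lf].
  apply: (kmem_root kK N0 (kmemD kK Kl (kmem_const (c *+ N - d) kK hK))).
  exact: efN.
exists (c *+ N - d) => //.
case: Kl => h /KL Lh eh.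
have LfN : kmem L (fun y => fr_val f y *~ N) by apply: kmemMz => //; exists f.
have Ll : kmem L (fun y => affine d l y *~ (- 1)) by apply: kmemMz => //; exists h.
apply: kmem_ext (kmemD kL LfN Ll) => y; rewrite -[_ *~ N]/(_ *+ N) efN mulrN1z.
by rewrite addrC addKr.
Qed.

Lemma slope_of_in K f c m : is_kernel K -> has_const K -> fr_val f =1 affine c m ->
  slope_of K (ratv m) -> K f.
Proof. by move=> kK hK ef /(slope_of_cases kK ef)[//|[/(_ hK)]]. Qed.

(** If all exponents agreed, the two monomials would differ by a tangible constant of value
    [tv h - tv g] and be proportional. *)
Lemma Lmonomial_affine f : Lmonomial f ->
  exists c m, fr_val f =1 affine c m /\ exists i, m i != 0.
Proof.
move=> [h [g [np /(fr_eqP arch) e]]].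
pose tv (a : monomial F n) := to_value arch (sval (mcoef a)).
exists (tv h - tv g), (fun i => (mexp h i)%:Z - (mexp g i)%:Z); split.
  move=> y; rewrite e /fr_val /poly_val /= /mono_val opprD addrACA; congr (_ + _).
  by rewrite -sumrB; apply: eq_bigr => i _; rewrite mulrzBr.
apply: contrapT => no; apply: np.
have hg i : mexp h i = mexp g i.
  by apply/eqP; apply: contrapT => /negP ne; apply: no; exists i; rewrite subr_eq0.
have [t tt et] := tangible_value (tv h - tv g).
exists (exist _ t tt); apply/(fr_eqP arch) => y; rewrite fr_val_mul fr_val_const /= et.
rewrite /fr_val /= /poly_val /= addrA; congr (_ - _); rewrite /mono_val addrA subrK.
by congr (_ + _); apply: eq_bigr => i _; rewrite hg.
Qed.

(** Indexed by [nat] to allow recursion on [j]; for j >= n all exponents vanish and this is the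
    constant 1. *)
Definition fr_var (j : nat) : fraction F n :=
  fr_of_monomial (Monomial (tone F) (fun i : 'I_n => (i == j :> nat) : nat)).

Definition unit_slope (j : nat) (i : 'I_n) : int := (i == j :> nat) : nat.

Lemma fr_val_monomial (h : monomial F n) y : fr_val (fr_of_monomial h) y = mono_val h y.
Proof.
rewrite /fr_val /= /poly_val /= {2}/mono_val /= big1 => [|i _]; last by rewrite mulr0n.
by rewrite -[to_value arch 1%g]/(0 : G) addr0 subr0.
Qed.

Lemma fr_val_var_affine j : fr_val (fr_var j) =1 affine 0 (unit_slope j).
Proof. by move=> y; rewrite fr_val_monomial. Qed.

Lemma fr_val_var (j : 'I_n) y : fr_val (fr_var j) y = y j.
Proof.
rewrite fr_val_var_affine /affine add0r (bigD1 j) //= /unit_slope eqxx mulr1z.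
by rewrite big1 ?addr0 // => i ij; rewrite (inj_eq val_inj) (negbTE ij) mulr0z.
Qed.

(** All monomials lie in [K] by their slopes, hence their maxima, the polynomials, and then the
    differences of these. *)
Lemma kernel_full K : is_kernel K -> has_const K ->
  (forall v, slope_of K v) -> K = setT.
Proof.
move=> kK hK sK; apply/seteqP; split=> // f _.
have Km (h : monomial F n) : K (fr_of_monomial h).
  apply: (slope_of_in kK hK (c := to_value arch (sval (mcoef h)))
            (m := fun i => mexp h i)) => // y.
  by rewrite fr_val_monomial.
have Kp (p : polynomial F n) : kmem K (poly_val p).
  case: p => a s; elim/last_ind: s => [|s b [g Kg eg]].
    by exists (fr_of_monomial a) => // y; rewrite fr_val_monomial.
  exists (fr_add g (fr_of_monomial b)); first exact: kernel_add.
  move=> y; rewrite fr_val_add fr_val_monomial eg /poly_val /= -cats1.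
  by rewrite foldl_cat.
apply: kmem_val => //.
apply: kmem_ext (kmemD kK (Kp (num f)) (kmemMz (- 1) kK (Kp (den f)))) => y.
by rewrite mulrN1z.
Qed.

End AffineFunctions.

(** * Hyperdimension *)

Section Spectrum.
Variables (F : nuSemifieldType) (arch : nu_archimedean F) (n : nat).
Variable u : value arch.
Hypothesis u0 : u != 0.
Local Notation G := (value arch).
Implicit Types (f g : fraction F n) (K L : set (fraction F n)).
Implicit Types (y : 'I_n -> G) (m : 'I_n -> int) (c : G) (v : 'rV[rat]_n).

(** Induction on the construction of the members [L] of [Omega] inside [K]; the result is the case
    [L = K]. *)
Lemma HSpec_gen_Lmonomial K : HSpec K -> K `<=` kernel_gen (K `&` HP F n).
Proof.
move=> [OK _ irr]; have kN := kernel_gen_is_kernel (K `&` HP F n).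
suff H L : Omega L -> L `<=` K -> L `<=` kernel_gen (K `&` HP F n) by exact: H.
elim=> {L} [|L [f Lf ->] fK|L M OL IHL OM IHM LM|L M OL IHL OM IHM LM].
- by move=> _; apply: kernel_gen_min => // f ->; exact: (kernel_one kN).
- apply: kernel_gen_min => // g ->; apply: sub_kernel_gen; split=> //.
  by apply: fK; apply: sub_kernel_gen.
(* By irreducibility [L] or [M] already lies in [K], and its induction hypothesis covers the
   intersection. *)
- have [/IHL LN f [/LN]//|nL] := pselect (L `<=` K).
  have [/IHM MN f [_ /MN]//|nM] := pselect (M `<=` K).
  by case: irr; exists L, M.
- apply: (kernel_prod_min arch kN).
    by apply: IHL; apply: subset_trans LM; apply: (sub_kernel_prodl arch);
      exact: (Omega_kernel arch).
  by apply: IHM; apply: subset_trans LM; apply: (sub_kernel_prodr arch);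
    exact: (Omega_kernel arch).
Qed.

Lemma HSpec_chain_step K L : HSpec K -> is_kernel L -> ~ K `<=` L ->
  exists f, [/\ K f, Lmonomial f & ~ L f].
Proof.
move=> HK kL nKL; apply: contrapT => H; apply: nKL.
apply: subset_trans (HSpec_gen_Lmonomial HK) _; apply: kernel_gen_min => // f [Kf Lf].
by apply: contrapT => nLf; apply: H; exists f.
Qed.

Lemma free_size_le (X : seq 'rV[rat]_n) : free X -> (size X <= n)%N.
Proof. by move/eqP <-; rewrite (leq_trans (dimvS (subvf _))) // dimvf /dim /= mul1n. Qed.

Lemma free_full (X : seq 'rV[rat]_n) v : free X -> size X = n -> v \in <<X>>%VS.
Proof.
move=> /eqP fX sX; suff -> : <<X>>%VS = fullv by exact: memvf.
by apply/eqP; rewrite eqEdim subvf fX sX dimvf /dim /= mul1n.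
Qed.

(* Along a chain every strict inclusion adds a new slope to the span of the
   slopes, except that once it may instead add the nonzero constants. *)
Lemma HSpec_chain_bound K : ~ HSpec_chain n.+1 K.
Proof.
move=> [P [HP_ Plt PK]].
have kP i : (i <= n.+1)%N -> is_kernel (P i).
  by move=> /HP_[/(Omega_kernel arch)].
(* Invariant: [P i] has at least [i] independent slopes, or at least [i - 1] of them together with a
   nonzero constant. *)
have claim i : (i <= n.+1)%N -> exists X : seq 'rV[rat]_n,
    [/\ free X, forall v, v \in X -> slope_of arch (P i) v &
      (i <= size X)%N \/ (i <= (size X).+1)%N /\ has_const arch (P i)].
  elim: i => [|i IH] lei.
    by exists [::]; split=> //; [rewrite nil_free|left].
  have [X [fX sX card]] := IH (ltnW lei).
  have [Pi nPi] := Plt i lei.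
  have [f [Pf Lf nf]] := HSpec_chain_step (HP_ _ lei) (kP _ (ltnW lei)) nPi.
  have [c [m [ef _]]] := Lmonomial_affine arch Lf.
  have hC : has_const arch (P i) -> has_const arch (P i.+1).
    by move=> [x x0 [g /Pi Pg e]]; exists x => //; exists g.
  have sX' v : v \in X -> slope_of arch (P i.+1) v.
    by move=> /sX; apply: slope_of_mono.
  (* If the slope of [f] is not new, [P i] has no nonzero constant and [P i.+1] acquires one, so
     this case occurs only once. *)
  have [mX|mX] := boolP (ratv m \in <<X>>%VS).
    have := slope_of_span (kP _ (ltnW lei)) sX mX.
    case/(slope_of_cases (kP _ (ltnW lei)) ef) => [//|[nC /(_ _ (kP _ lei) Pi Pf) Cn]].
    by exists X; split=> //; right; split=> //; case: card => [//|[]].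
  exists (ratv m :: X); split; first by rewrite free_cons mX.
    move=> v; rewrite inE => /predU1P[->|/sX'//].
    exact: slope_of_mem Pf ef.
  by case: card => [le|[le Ci]]; [left|right; split=> //; exact: hC].
have [X [fX sX card]] := claim _ (leqnn _).
have leX := free_size_le fX.
case: card => [le|[le Cn]]; first by have := leq_trans le leX; rewrite ltnn.
have eX : size X = n by apply/eqP; rewrite eqn_leq leX.
(* All slopes and a nonzero constant are now present, which contradicts properness. *)
have [_ + _] := HP_ _ (leqnn _); apply.
apply: (kernel_full (kP _ (leqnn _)) Cn) => v.
by apply: slope_of_span (kP _ _) sX _ => //; apply: free_full.
Qed.

(** Without a height at most [n], every chain length from 0 to n + 1 would occur below [K]. *)
Lemma HSpec_has_height K : HSpec K -> exists2 t, (t <= n)%N & has_height K t.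
Proof.
move=> HK; apply: contrapT => H; apply: (@HSpec_chain_bound K).
suff : forall t, (t <= n.+1)%N -> HSpec_chain t K by apply.
elim=> [|t IH] le; first by exists (fun=> K); split.
apply: contrapT => nch; apply: H; exists t; first exact: le.
by split=> //; apply: IH; apply: ltnW.
Qed.

(** * The chain of coordinate kernels *)

Fixpoint coord_kernel (j : nat) : set (fraction F n) :=
  if j is i.+1 then kernel_prod (coord_kernel i) (kernel_gen [set fr_var F n i])
  else trivial_kernel F n.

(** A variable proportional to 1 would be a constant function, but it takes the distinct values 0
    and [u]. *)
Lemma Lmonomial_var j : (j < n)%N -> Lmonomial (fr_var F n j).
Proof.
move=> jn; pose h : monomial F n := Monomial (tone F) (fun i : 'I_n => (i == j :> nat) : nat).
exists h, (Monomial (tone F) (fun=> 0%N)); split.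
  move=> [c /(fr_eqP arch) e].
  have {}e y : y (Ordinal jn) = to_value arch (sval c).
    rewrite -fr_val_var /=; have := e y; rewrite [LHS]/= => ->.
    rewrite fr_val_mul fr_val_const fr_val_monomial /mono_val /= big1 => [|i _].
      by rewrite -[to_value arch 1%g]/(0 : G) !addr0.
    by rewrite mulr0n.
  by move/eqP: u0; apply; rewrite (e (fun=> u)) -(e (fun=> 0)).
by apply/(fr_eqP arch) => y.
Qed.

Lemma var_not_proportional i j : (i < n)%N -> i <> j ->
  ~ proportional (fr_var F n i) (fr_var F n j).
Proof.
move=> lin ij [c /(fr_eqP arch) e].
have ej y : (forall k : 'I_n, k = j :> nat -> y k = 0) ->
    y (Ordinal lin) = to_value arch (sval c).
  move=> yj; rewrite -fr_val_var /= e fr_val_mul fr_val_const fr_val_var_affine /affine.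
  rewrite add0r big1 ?addr0 // => k _; rewrite /unit_slope.
  by case: eqP => [/yj ->|_]; rewrite ?mul0rz ?mulr0z.
have := ej (fun k => if k == j :> nat then 0 else u).
rewrite -(ej (fun=> 0)) //= ifN; last exact/eqP.
by move=> H; move/eqP: u0; apply; apply: H => k ->; rewrite eqxx.
Qed.

Lemma coord_kernel_Omega j : (j <= n)%N -> Omega (coord_kernel j).
Proof.
elim: j => [|j IH] le /=; first exact: Omega_trivial.
apply: Omega_prod; first exact/IH/ltnW.
by apply: Omega_HP; exists (fr_var F n j) => //; apply: Lmonomial_var.
Qed.

Lemma coord_kernel_is_kernel j : is_kernel (coord_kernel j).
Proof.
elim: j => [|j IH] /=; first exact: kernel_gen_is_kernel.
exact: (kernel_prod_is_kernel arch IH (kernel_gen_is_kernel _)).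
Qed.

Lemma coord_kernel_var i j : (i < j)%N -> coord_kernel j (fr_var F n i).
Proof.
elim: j => // j IH; rewrite ltnS leq_eqVlt => /orP[/eqP ->|ij] /=.
  apply: (sub_kernel_prodr arch (coord_kernel_is_kernel j)).
  exact: sub_kernel_gen.
by apply: (sub_kernel_prodl arch (kernel_gen_is_kernel _)); apply: IH.
Qed.

(** The functions vanishing at [y] form a kernel that contains the generators. *)
Lemma coord_kernel_vanish j f y : (forall i : 'I_n, (i < j)%N -> y i = 0) ->
  coord_kernel j f -> fr_val f y = 0.
Proof.
move=> yj; pose V := [set g : fraction F n |
  exists2 c, c = 0 & forall z, [set y] z -> vabs (fr_val g z) <= c].
have kV : is_kernel V by apply: bounded_kernel => // a b -> ->; rewrite addr0.
suff sV : coord_kernel j `<=` V.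
  move=> /sV[c -> /(_ y erefl) le]; apply/eqP; rewrite -vabs_eq0.
  by apply/eqP/le_anti; rewrite le vabs_ge0.
elim: j yj => [|j IH] yj /=.
  by apply: kernel_gen_min => // g ->; apply: (kernel_one kV).
apply: (kernel_prod_min arch kV); first by apply: IH => i ij; apply: yj; apply: ltnW.
apply: kernel_gen_min => // g ->; exists 0 => // z ->.
rewrite fr_val_var_affine /affine add0r big1 ?/vabs ?oppr0 ?maxxx // => i _.
by rewrite /unit_slope; case: eqP => [ij|_]; rewrite ?mulr0z // yj ?mul0rz // ij.
Qed.

Lemma coord_kernel_proper j : (j < n)%N -> coord_kernel j `<` coord_kernel j.+1.
Proof.
move=> jn; split=> [|/(_ _ (coord_kernel_var (ltnSn j)))].
  exact: (sub_kernel_prodl arch (kernel_gen_is_kernel _)).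
(* At this point the first [j] coordinates vanish while the next variable takes the value [u]. *)
move=> /(@coord_kernel_vanish j _ (fun i => if (i < j)%N then 0 else u)).
rewrite (fr_val_var (Ordinal jn)) /= ltnn => H; move/eqP: u0; apply; apply: H.
by move=> i ->.
Qed.

Lemma const_fraction c : exists f, forall y, fr_val f y = c.
Proof.
have [t tt e] := tangible_value c.
by exists (fr_const n (exist _ t tt)) => y; rewrite fr_val_const.
Qed.

Lemma coord_kernel_neqT j : coord_kernel j <> setT.
Proof.
move=> e; have [f ef] := const_fraction u.
have : coord_kernel j f by rewrite e.
by move=> /(@coord_kernel_vanish j _ (fun=> 0)); rewrite ef => H; move/eqP: u0; apply; apply: H.
Qed.

(** * Zeros along the moment curve and irreducibility of the coordinate kernels *)

Definition curve j (T : nat) (i : 'I_n) : G :=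
  if (i < j)%N then 0 else u *~ (T%:Z ^+ i.+1).

(** Not vanishing at some point is lost under minima, whereas having boundedly many zeros is
    preserved. *)
Definition bounded_zeros j f := exists d, forall rs : seq nat,
  uniq rs -> (forall T, T \in rs -> fr_val f (curve j T) = 0) -> (size rs <= d)%N.

(** Along the curve the value is c + u q(T) with [q] an integer polynomial without constant term. If
    q = 0, either c = 0 and only the first [j] variables occur, or there are no zeros. *)
Lemma Lmonomial_bounded_zeros j f : Lmonomial f ->
  coord_kernel j f \/ bounded_zeros j f.
Proof.
move=> /(Lmonomial_affine arch)[c [m [ef _]]].
pose q : {poly int} := \sum_(i < n | (j <= i)%N) m i *: 'X^(i.+1).
have ev T : fr_val f (curve j T) = c + u *~ q.[T%:Z].
  rewrite ef /affine; congr (_ + _).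
  rewrite (bigID (fun i : 'I_n => (i < j)%N)) /= big1 => [|i ij]; last first.
    by rewrite /curve ij mul0rz.
  rewrite add0r horner_sum mulrz_sumr; apply: eq_big => [i|i]; first by rewrite -leqNgt.
  rewrite -leqNgt /curve => ji; rewrite ltnNge ji /= hornerZ hornerXn -mulrzA.
  by rewrite mulrC.
have [mj|mj] := pselect (forall i : 'I_n, (j <= i)%N -> m i = 0).
  have q0 : q = 0 by apply: big1 => i /mj ->; rewrite scale0r.
  have [c0|c0] := eqVneq c 0; [left|right].
    have kj := coord_kernel_is_kernel j.
    apply: (kmem_val (arch := arch)) => //.
    have fE : (fun y : 'I_n -> G => \sum_(i < n | (i < j)%N) y i *~ m i) =1 fr_val f.
      move=> y; rewrite ef /affine c0 add0r [RHS](bigID (fun i : 'I_n => (i < j)%N)) /=.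
      by rewrite [X in _ = _ + X]big1 ?addr0 // => i; rewrite -leqNgt => /mj ->; rewrite mulr0z.
    apply: (kmem_ext fE); apply: kmem_sum => // i ij; apply: kmemMz => //.
    by exists (fr_var F n i); [exact: coord_kernel_var|exact: fr_val_var].
  exists 0%N => -[//|T rs] _ /(_ T); rewrite inE eqxx ev q0 horner0 mulr0z addr0.
  by move=> /(_ isT) /eqP; rewrite (negbTE c0).
right; exists (size q).+1 => -[//|T0 rs] urs zrs.
(* Since [c] need not be a multiple of [u], one zero [T0] is fixed and any zero [T] satisfies q(T) =
   q(T0). The difference is nonzero because its coefficient at the positive exponent [i.+1] is
   [m i]. *)
have p0 : q - (q.[T0%:Z])%:P != 0.
  apply: contra_notN mj => /eqP/subr0_eq eq i ji.
  have := congr1 (fun p : {poly int} => p`_(i.+1)) eq; rewrite coefC /= coef_sum.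
  rewrite (bigD1 i) //= coefZ coefXn eqxx mulr1 big1 ?addr0 // => k /andP[_ ki].
  by rewrite coefZ coefXn eqSS eq_sym (inj_eq val_inj) (negbTE ki) mulr0.
have /(max_poly_roots p0) : all (root (q - (q.[T0%:Z])%:P)) (map Posz (T0 :: rs)).
  apply/allP => _ /mapP[T Ts ->]; rewrite /root hornerD hornerN hornerC subr_eq0.
  have T0z : fr_val f (curve j T0) = 0 by apply: zrs; rewrite inE eqxx.
  have := congr2 (fun a b => a - b) (zrs T Ts) T0z.
  rewrite !ev opprD addrACA subrr add0r subr0 -mulrzBr => /eqP.
  by rewrite vmulrz_eq0 (negbTE u0) subr_eq0.
rewrite map_inj_uniq ?urs => [/(_ isT)|? ? []//]; rewrite size_map => le.
apply: leq_trans (ltnW le) _; apply: leq_trans (size_polyD _ _) _.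
rewrite size_polyN geq_max leqnSn (leq_trans (size_polyC_leq1 _)) //.
Qed.

(** A zero of the minimum is a zero of [f] or of [g], so the two bounds add up. *)
Lemma bounded_zeros_min j f g : bounded_zeros j f -> bounded_zeros j g ->
  bounded_zeros j (fr_min (fr_abs f) (fr_abs g)).
Proof.
move=> [d fd] [e ge]; exists (d + e)%N => rs urs zrs.
pose zf T := fr_val f (curve j T) == 0.
rewrite -(count_predC zf rs) -!size_filter leq_add //.
  by apply: fd; rewrite ?filter_uniq // => T; rewrite mem_filter => /andP[/eqP].
apply: ge; rewrite ?filter_uniq // => T; rewrite mem_filter => /andP[/negbTE zT /zrs].
rewrite fr_val_min !fr_val_abs => m0; apply/eqP; rewrite -vabs_eq0; apply/eqP.
move: m0; case: leP => // _ /eqP; by rewrite vabs_eq0 [_ == _]zT.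
Qed.

(** The minimum of the absolute values is dominated by each of them, hence lies in both kernels. *)
Lemma bounded_zeros_cap j K L f g : is_kernel K -> is_kernel L ->
  K f -> bounded_zeros j f -> L g -> bounded_zeros j g ->
  exists2 h, (K `&` L) h & bounded_zeros j h.
Proof.
move=> kK kL Kf zf Lg zg.
exists (fr_min (fr_abs f) (fr_abs g)); last exact: bounded_zeros_min.
have minE y : fr_val (fr_min (fr_abs f) (fr_abs g)) y =
    Num.min (vabs (fr_val f y)) (vabs (fr_val g y)) by rewrite fr_val_min !fr_val_abs.
have absE y : vabs (fr_val (fr_min (fr_abs f) (fr_abs g)) y) =
    Num.min (vabs (fr_val f y)) (vabs (fr_val g y)).
  have m0 : 0 <= Num.min (vabs (fr_val f y)) (vabs (fr_val g y)).
    by rewrite le_min !vabs_ge0.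
  by rewrite minE [LHS]max_l // (le_trans _ m0) // voppr_le0.
split; [apply: (kernel_dominated kK (kernel_abs arch kK Kf)) => y|
        apply: (kernel_dominated kL (kernel_abs arch kL Lg)) => y].
  by rewrite absE fr_val_abs ge_min lexx.
by rewrite absE fr_val_abs ge_min lexx orbT.
Qed.

(** Extends the dichotomy for L-monomials to [Omega] by induction on the construction. *)
Lemma Omega_bounded_zeros j L : Omega L ->
  L `<=` coord_kernel j \/ exists2 f, L f & bounded_zeros j f.
Proof.
have kj := coord_kernel_is_kernel j.
elim=> {L} [|L [f Lf ->]|L M OL [IHL|[f Lf zf]] OM IHM|L M OL IHL OM IHM].
- by left; apply: kernel_gen_min => // f ->; exact: (kernel_one kj).
- case: (Lmonomial_bounded_zeros j Lf) => zf; [left|right].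
    by apply: kernel_gen_min => // g ->.
  by exists f => //; apply: sub_kernel_gen.
- by left=> f [/IHL].
- case: IHM => [IHM|[g Mg zg]]; first by left=> h [_ /IHM].
  by right; apply: (bounded_zeros_cap _ _ Lf zf Mg zg); apply: (Omega_kernel arch).
- case: IHL => [IHL|[f Lf zf]]; last first.
    right; exists f => //; apply: (sub_kernel_prodl arch) => //; exact: (Omega_kernel arch).
  case: IHM => [IHM|[f Mf zf]]; last first.
    right; exists f => //; apply: (sub_kernel_prodr arch) => //; exact: (Omega_kernel arch).
  by left; apply: (kernel_prod_min arch kj).
Qed.

(** Reducibility would yield an element of the kernel with at most [d] zeros on the curve, yet it
    vanishes at the parameters 0, ..., d. *)
Lemma coord_kernel_HSpec j : (j <= n)%N -> HSpec (coord_kernel j).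
Proof.
move=> jn; split; [exact: coord_kernel_Omega|exact: coord_kernel_neqT|].
move=> [L [M [OL OM nL nM LM]]].
case: (Omega_bounded_zeros j OL) => [//|[f Lf zf]].
case: (Omega_bounded_zeros j OM) => [//|[g Mg zg]].
have [h /LM Kh [d zh]] :=
  bounded_zeros_cap (Omega_kernel arch OL) (Omega_kernel arch OM) Lf zf Mg zg.
have := zh (iota 0 d.+1) (iota_uniq _ _); rewrite size_iota ltnn => F0.
suff : false by []; apply: F0 => T _.
by apply: (coord_kernel_vanish _ Kh) => i ij; rewrite /curve ij.
Qed.

Lemma coord_kernel_has_height : has_height (coord_kernel n) n.
Proof.
split; last exact: HSpec_chain_bound.
exists coord_kernel; split=> // [i le|i lt]; first exact: coord_kernel_HSpec.
exact: coord_kernel_proper.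
Qed.

End Spectrum.

(** * Convex dimension *)

Section ConvexDimension.
Variables (F : nuSemifieldType) (arch : nu_archimedean F) (n : nat).
Variable alpha : tangible_elt F.
Local Notation G := (value arch).
Local Notation u := (to_value arch (sval alpha)).
Hypothesis u0 : u != 0.
Implicit Types (f g h : fraction F n) (A B C K L : set (fraction F n)).
Implicit Types (y : 'I_n -> G) (m : 'I_n -> int) (c : G) (v w : 'rV[rat]_n).

(** * Slopes of L-monomials and convex dependence *)

Lemma affine_inj c c' m m' : affine c m =1 affine c' m' -> m =1 m'.
Proof.
move=> e i; have := e (fun=> 0); rewrite /affine.
rewrite !big1; try by move=> k _; rewrite mul0rz.
rewrite !addr0 => ec; have := e (fun k => if k == i then u else 0).
have sE (l : 'I_n -> int) : \sum_k (if k == i then u else 0) *~ l k = u *~ l i.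
  rewrite (bigD1 i) //= eqxx big1 ?addr0 // => k /negbTE ->; exact: mul0rz.
rewrite /affine ec => /addrI; rewrite !sE => /eqP.
by rewrite -subr_eq0 -mulrzBr vmulrz_eq0 (negbTE u0) subr_eq0 => /eqP.
Qed.

(** Uniqueness of the chosen vector is [affine_inj]; the default 0 is taken only by fractions that
    are not affine, never on [HP]. *)
Definition slope f : 'rV[rat]_n :=
  xget 0 [set v | exists c m, fr_val f =1 (affine c m : _ -> G) /\ v = ratv m].

Lemma slopeE f c m : fr_val f =1 (affine c m : _ -> G) -> slope f = ratv m.
Proof.
move=> e; rewrite /slope; case: xgetP => [v _ [d [l [e' ->]]]|/(_ (ratv m)) []]; last first.
  by exists c, m.
apply/rowP => i; rewrite !mxE (@affine_inj d c l m) // => y.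
by rewrite -e' e.
Qed.

Lemma slopeP f : Lmonomial f ->
  exists c m, fr_val f =1 (affine c m : _ -> G) /\ slope f = ratv m.
Proof.
by move=> /(Lmonomial_affine arch)[c [m [e _]]]; exists c, m; rewrite (slopeE e).
Qed.

Lemma slope_var (j : 'I_n) : slope (fr_var F n j) = delta_mx 0 j.
Proof.
rewrite (slopeE (@fr_val_var_affine _ arch _ j)); apply/rowP => i.
by rewrite !mxE /unit_slope eqxx /= (inj_eq val_inj).
Qed.

Lemma dependence_kernel A :
  is_kernel (kernel_prod (kernel_gen A) (kernel_F n alpha)).
Proof. by apply: (kernel_prod_is_kernel arch); apply: kernel_gen_is_kernel. Qed.

Lemma convexly_dependent_mono A B f : A `<=` B ->
  convexly_dependent alpha f A -> convexly_dependent alpha f B.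
Proof.
move=> AB [a [b [Ha Hb e]]]; exists a, b; split=> //.
exact: kernel_gen_mono AB _ Ha.
Qed.

(** The factor [kernel_F] supplies all constants, so only slopes decide membership. *)
Lemma dependent_of_span A (X : seq 'rV[rat]_n) f : A `<=` HP F n ->
  (forall v, v \in X -> exists2 a, A a & slope a = v) ->
  Lmonomial f -> slope f \in <<X>>%VS -> convexly_dependent alpha f A.
Proof.
move=> AHP XA /slopeP[c [m [ef ->]]] mX; have kD := dependence_kernel A.
apply: (slope_of_in kD _ ef).
  exists u => //; exists (fr_const n alpha); last by move=> y; rewrite fr_val_const.
  by apply: (sub_kernel_prodr arch (kernel_gen_is_kernel _)); apply: sub_kernel_gen.
apply: (slope_of_span kD _ mX) => v /XA[a Aa <-].
have [d [l [ea ->]]] := slopeP (AHP _ Aa); apply: slope_of_mem ea.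
by apply: (sub_kernel_prodl arch (kernel_gen_is_kernel _)); apply: sub_kernel_gen.
Qed.

(** The functional is a coordinate of [x - projv U x], which vanishes on [U] but not at [v]; the
    product [D] of the denominators makes it integral. *)
Lemma separating_direction (U : {vspace 'rV[rat]_n}) v : v \notin U ->
  exists w : 'I_n -> int,
    (forall m, ratv m \in U -> \sum_i w i * m i = 0) /\
    (forall m, v = ratv m -> \sum_i w i * m i != 0).
Proof.
move=> vU; pose psi x : 'rV[rat]_n := x - projv U x.
have [i0 vi0] : exists i, psi v 0 i != 0.
  apply: contrapT => H; move/negP: vU; apply.
  suff /subr0_eq -> : psi v = 0 by apply: memv_proj.
  apply/rowP => i; rewrite [RHS]mxE; apply/eqP; apply: contrapT => /negP ne.
  by apply: H; exists i.
pose phi i : rat := psi (delta_mx 0 i) 0 i0.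
pose D : int := \prod_i denq (phi i).
pose w i : int := numq (phi i) * \prod_(k | k != i) denq (phi k).
have wE i : (w i)%:~R = D%:~R * phi i.
  have -> : D = denq (phi i) * \prod_(k | k != i) denq (phi k).
    by rewrite /D (bigD1 i).
  by rewrite /w !intrM numqE -[LHS]mulrA [LHS]mulrC.
have sumE m : (\sum_i w i * m i)%:~R = D%:~R * psi (ratv m) 0 i0.
  rewrite (row_sum_delta (ratv m)) /psi linear_sum -sumrB summxE mulr_sumr rmorph_sum.
  apply: eq_bigr => i _ /=; rewrite intrM wE -mulrA; congr (_ * _).
  by rewrite linearZ -scalerBr [RHS]mxE mxE mulrC.
have D0 : D%:~R != 0 :> rat.
  by rewrite intr_eq0; apply/prodf_neq0 => i _; rewrite denq_eq0.
exists w; split=> m.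
  by move=> mU; apply/eqP; rewrite -(intr_eq0 rat) sumE /psi projv_id // subrr mxE mulr0.
by move=> e; rewrite -(intr_eq0 rat) sumE -e mulf_neq0.
Qed.

(* Along the ray in a separating direction every element of [A] stays bounded,
   whereas [f] does not. *)
Lemma independent_of_notin A (U : {vspace 'rV[rat]_n}) f : A `<=` HP F n ->
  (forall a, A a -> slope a \in U) -> Lmonomial f -> slope f \notin U ->
  ~ convexly_dependent alpha f A.
Proof.
move=> AHP AU /slopeP[c [m [ef em]]] /separating_direction[w [wU wf]].
pose ray N : 'I_n -> G := fun i => u *~ (N%:Z * w i).
have rayE d l N : affine d l (ray N) = d + u *~ (\sum_i w i * l i) *+ N.
  rewrite /affine; congr (_ + _).
  rewrite pmulrn -mulrzA mulr_suml mulrz_sumr; apply: eq_bigr => i _.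
  by rewrite /ray -mulrzA -mulrA [N%:Z * _]mulrC.
pose K := [set g | exists2 b : G, True & forall y, range ray y -> vabs (fr_val g y) <= b].
have kK : is_kernel K by apply: bounded_kernel.
have sK : kernel_prod (kernel_gen A) (kernel_F n alpha) `<=` K.
  (* Members of [A] are constant along the ray, as their slopes are orthogonal to [w]. *)
  apply: (kernel_prod_min arch kK); apply: kernel_gen_min => //.
    move=> a Aa; have [d [l [ea el]]] := slopeP (AHP _ Aa).
    exists (vabs d) => // _ [N _ <-].
    by rewrite ea rayE wU ?mulr0z ?mul0rn ?addr0 // -el AU.
  by move=> _ ->; exists (vabs u) => // y _; rewrite fr_val_const.
move=> /sK[b _ fb]; pose x := u *~ (\sum_i w i * m i).
have x0 : 0 < vabs x.
  by rewrite lt_neqAle vabs_ge0 eq_sym vabs_eq0 vmulrz_eq0 (negbTE u0) wf.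
have [N ltN] := value_arch (b + vabs c) x0.
have := fb (ray N); rewrite ef rayE => /(_ (ex_intro2 _ _ N I erefl)).
rewrite -/x vabs_le => /andP[le1 le2].
have [c1 c2] : c <= vabs c /\ - c <= vabs c by rewrite !le_max !lexx orbT.
have : vabs (x *+ N) <= b + vabs c.
  rewrite vabs_le; apply/andP; split.
    by rewrite -[x *+ N](addKr c) addrC vleD.
  by rewrite -[_ *+ N](addKr c) addrC opprB [_ - _]addrC vleD.
by rewrite vabs_muln leNgt ltN.
Qed.

(** Injectivity puts the slopes of the other members in [Z] without [slope h], and freeness keeps
    [slope h] out of their span. *)
Lemma free_independent C (Z : seq 'rV[rat]_n) : C `<=` HP F n -> free Z ->
  (forall h, C h -> slope h \in Z) ->
  (forall h h', C h -> C h' -> slope h = slope h' -> h = h') ->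
  convexly_independent alpha C.
Proof.
move=> CHP fZ CZ Cinj h Ch; have hZ := CZ _ Ch.
apply: (@independent_of_notin _ <<rem (slope h) Z>>).
- by move=> a [/CHP].
- move=> a [Ca ah]; apply: memv_span; rewrite mem_rem_uniq ?free_uniq // inE CZ // andbT.
  by apply/eqP => /(Cinj _ _ Ca Ch).
- exact: CHP.
- by move: fZ; rewrite (perm_free (perm_to_rem hZ)) free_cons => /andP[].
Qed.

(** A slope in the span of the later ones would make its L-monomial dependent on theirs, which are
    different members of [B] because [X] has no repetition. *)
Lemma independent_free B (X : seq 'rV[rat]_n) : B `<=` HP F n ->
  convexly_independent alpha B -> uniq X ->
  (forall v, v \in X -> exists2 h, B h & slope h = v) -> free X.
Proof.
move=> BHP iB; elim: X => [|v X IH] /=; first by rewrite nil_free.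
move=> /andP[vX uX] XB; rewrite free_cons IH // ?andbT; last first.
  by move=> w wX; apply: XB; rewrite inE wX orbT.
apply/negP => vs; have [h Bh hv] := XB v (mem_head _ _).
apply: (iB h Bh); apply: (@dependent_of_span _ X); last by rewrite hv.
- by move=> a [/BHP].
- move=> w wX; have [a Ba aw] := XB w (mem_behead (s := v :: X) wX).
  by exists a => //; split=> // ah; move: vX; rewrite -hv -ah aw wX.
- exact: BHP.
Qed.

(** Two distinct members with the same slope would be dependent on each other. *)
Lemma independent_slope_inj B : B `<=` HP F n -> convexly_independent alpha B ->
  forall h h', B h -> B h' -> slope h = slope h' -> h = h'.
Proof.
move=> BHP iB h h' Bh Bh' e; apply: contrapT => hh'; apply: (iB h Bh).
apply: (@dependent_of_span _ [:: slope h']); [by move=> a [/BHP]| |exact: BHP|].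
  by move=> v; rewrite inE => /eqP ->; exists h' => //; split=> // /esym.
by rewrite e memv_span ?mem_head.
Qed.

(** * Bases and their cardinality *)

Lemma span_unit_rows (U : {vspace 'rV[rat]_n}) :
  (forall i, delta_mx 0 i \in U) -> U = fullv.
Proof.
move=> H; apply/eqP; rewrite eqEsubv subvf; apply/subvP => v _.
by rewrite (row_sum_delta v); apply: memv_suml => i _; apply: memvZ.
Qed.

Lemma dim_rows : \dim {:'rV[rat]_n} = n.
Proof. by rewrite dimvf /dim /= mul1n. Qed.

(** The variables form a basis: their slopes are the unit rows, which are free and span everything,
    so any further L-monomial depends on them. *)
Lemma exists_basis : exists B, is_basis alpha B.
Proof.
pose B := [set f : fraction F n | exists i : 'I_n, f = fr_var F n i].
pose Z := [seq (delta_mx 0 i : 'rV[rat]_n) | i <- enum 'I_n].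
have ZT : <<Z>>%VS = fullv.
  by apply: span_unit_rows => i; apply/memv_span/map_f; rewrite mem_enum.
have fZ : free Z by rewrite /free ZT dim_rows size_map size_enum_ord.
have BHP : B `<=` HP F n by move=> _ [i ->]; apply: (Lmonomial_var u0).
have iB : convexly_independent alpha B.
  apply: (free_independent BHP fZ) => [_ [i ->]|_ _ [i ->] [j ->]].
    by rewrite slope_var; apply: map_f; rewrite mem_enum.
  rewrite !slope_var => /rowP/(_ j); rewrite !mxE !eqxx /=.
  by case: eqP => [->//|_ /eqP]; rewrite eq_sym oner_eq0.
exists B; split=> // C CHP iC BC; apply/seteqP; split=> // h Ch.
apply: contrapT => nBh; apply: (iC h Ch).
apply: (@convexly_dependent_mono B) => [a Ba|].
  by split; [exact: BC|move=> ah; apply: nBh; rewrite -ah].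
apply: (@dependent_of_span _ Z) => //; last by rewrite ZT memvf.
  by move=> v /mapP[i _ ->]; exists (fr_var F n i); [exists i|exact: slope_var].
exact: CHP.
Qed.

(** With fewer than [n] slopes some unit row lies outside their span, and adjoining its variable
    contradicts maximality. *)
Lemma basis_full B (X : seq 'rV[rat]_n) : is_basis alpha B -> uniq X ->
  (forall v, v \in X -> exists2 h, B h & slope h = v) ->
  (forall h, B h -> slope h \in X) -> (n <= size X)%N.
Proof.
move=> [BHP iB mB] uX XB BX; rewrite leqNgt; apply/negP => ltn.
have fX := independent_free BHP iB uX XB.
have [j jX] : exists j : 'I_n, delta_mx 0 j \notin <<X>>%VS.
  apply: contrapT => H; move: ltn.
  rewrite -(eqP fX) (@span_unit_rows <<X>>) ?dim_rows ?ltnn // => i.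
  by apply: contrapT => /negP iX; apply: H; exists i.
have nB : ~ B (fr_var F n j).
  by move=> /BX/memv_span; rewrite slope_var (negbTE jX).
apply: (nB); rewrite -(mB (B `|` [set fr_var F n j])); first by right.
- by move=> f [/BHP//|->]; apply: (Lmonomial_var u0).
- have fZ : free (delta_mx 0 j :: X) by rewrite free_cons jX.
  apply: (free_independent _ fZ).
  + by move=> f [/BHP//|->]; apply: (Lmonomial_var u0).
  + by move=> h [/BX hX|->]; rewrite inE ?hX ?orbT // slope_var eqxx.
  + have sj h : B h -> slope h <> slope (fr_var F n j).
      by move=> /BX/memv_span + e; rewrite e slope_var (negbTE jX).
    move=> h h' [Bh|->] [Bh'|->] // e; first exact: (independent_slope_inj BHP iB).
      by case: (sj h).
    by case: (sj h').
- by move=> f; left.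
Qed.

Lemma basis_card B : is_basis alpha B -> (B #= `I_n)%card.
Proof.
move=> bB; have [BHP iB mB] := bB.
have claim k : (k <= n)%N -> exists X : seq 'rV[rat]_n, [/\ uniq X, size X = k &
    forall v, v \in X -> exists2 h, B h & slope h = v].
  elim: k => [|k IH] lek; first by exists [::].
  have [X [uX sX XB]] := IH (ltnW lek).
  have [[h Bh hX]|H] := pselect (exists2 h, B h & slope h \notin X).
    exists (slope h :: X); split; rewrite /= ?hX ?sX //.
    by move=> v; rewrite inE => /predU1P[->|/XB//]; exists h.
  (* Here [X] exhausts the slopes of [B], which [basis_full] excludes for k < n. *)
  have := basis_full bB uX XB; rewrite sX leqNgt lek => F0.
  suff : false by []; apply: F0 => h Bh.
  by apply: contrapT => /negP hX; apply: H; exists h.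
have [X [uX sX XB]] := claim n (leqnn _).
have BX h : B h -> slope h \in X.
  move=> Bh; apply: contrapT => /negP hX.
  have : free (slope h :: X).
    apply: (independent_free BHP iB); first by rewrite /= hX.
    by move=> v; rewrite inE => /predU1P[->|/XB//]; exists h.
  by move=> /free_size_le /=; rewrite sX ltnn.
(* [X] now lists exactly the slopes of [B], so positions in [X] number the members of [B] from 0 to
   n - 1. *)
have inj : {in B &, injective (fun h => index (slope h) X)}.
  move=> h h'; rewrite !inE => Bh Bh' e; apply: (independent_slope_inj BHP iB) => //.
  by rewrite -(nth_index 0 (BX _ Bh)) e nth_index // BX.
suff <- : (fun h => index (slope h) X) @` B = `I_n.
  exact: card_esym (inj_card_eq inj).
apply/seteqP; split=> [_ [h Bh <-]|k /= ltk]; first by have := BX _ Bh; rewrite -index_mem sX.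
have [|h Bh hk] := XB (nth 0 X k); first by rewrite mem_nth ?sX.
by exists h => //; rewrite hk index_uniq // sX.
Qed.

(** The sum of the absolute values of the variables lies in the kernel and dominates each of them,
    hence generates it. *)
Lemma coord_kernel_HS : HS_kernel alpha (@coord_kernel F n n).
Proof.
(* For n = 0 the kernel is the trivial one; otherwise the n = k + 1 summands fit [fr_sum] with last
   index [k]. *)
case en : n => [|k]; first by left.
right; exists (fr_sum (fun i => fr_abs (fr_var F k.+1 i)) k).
  exists k, (fr_var F k.+1); split=> // [i ik|i j ik jk].
    exact: (Lmonomial_var u0).
  exact: (var_not_proportional u0).
have sumK (K : set (fraction F k.+1)) (x : nat -> fraction F k.+1) t : is_kernel K ->
    (forall i, (i <= t)%N -> K (x i)) -> K (fr_sum (fun i => fr_abs (x i)) t).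
  move=> kK; elim: t => [|t IH] H /=; first by apply: (kernel_abs arch kK); apply: H.
  apply: (kernel_add arch kK); last by apply: (kernel_abs arch kK); apply: H.
  by apply: IH => i it; apply: H; apply: leqW.
have sum_ge (x : nat -> fraction F k.+1) t (y : 'I_k.+1 -> G) i : (i <= t)%N ->
    fr_val (x i) y <= fr_val (fr_sum x t) y.
  elim: t => [|t IH]; first by rewrite leqn0 => /eqP ->.
  rewrite leq_eqVlt ltnS /= fr_val_add le_max => /predU1P[->|/IH ->//].
  by rewrite lexx orbT.
apply/seteqP; split; last first.
  apply: kernel_gen_min; first exact: (coord_kernel_is_kernel arch).
  move=> _ ->; apply: sumK => [|i ik]; first exact: (coord_kernel_is_kernel arch).
  exact: (coord_kernel_var arch).
pose S := fr_sum (fun i => fr_abs (fr_var F k.+1 i)) k.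
have kS := kernel_gen_is_kernel [set S].
suff H j : (j <= k.+1)%N -> @coord_kernel F k.+1 j `<=` kernel_gen [set S] by exact: H.
elim: j => [|j IH] jk /=.
  by apply: kernel_gen_min => // g ->; apply: (kernel_one kS).
apply: (kernel_prod_min arch kS); first by apply: IH; exact: ltnW.
apply: kernel_gen_min => // _ ->.
have SS : kernel_gen [set S] S by apply: sub_kernel_gen.
apply: (kernel_dominated kS SS) => y.
have := sum_ge (fun i => fr_abs (fr_var F k.+1 i)) k y j jk.
by rewrite fr_val_abs.
Qed.

End ConvexDimension.

Theorem corollary3p53 (F : nuSemifieldType) (n : nat) (alpha : tangible_elt F) :
  nu_divisible F -> nu_archimedean F ->
  ~ nu_eq (sval alpha) (1%g : F) ->
  is_Hdim n alpha n /\ is_dconv n alpha n.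
Proof.
move=> _ arch a1.
have u0 : to_value arch (sval alpha) != 0.
  by apply/eqP => e; apply: a1; apply/(to_value_eq arch).
split; split.
- by exists (@coord_kernel F n n); [exact: coord_kernel_HS u0|exact: coord_kernel_has_height u0].
- by move=> K _; apply: HSpec_has_height.
- exact: exists_basis u0.
- exact: basis_card u0.
Qed.
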